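(* Suppose that there is a second order phase transition, i.e. $\left(\frac jc\right)'(\kappa)>0$ for all $\kappa\in(0,\kappa_{max})$ (with $\rho_c<\infty$), and consider the SOH model associated to the von Mises–Fisher equilibria for $\rho>\rho_c$, i.e. to the branch $\rho\mapsto\kappa(\rho)$ where $\kappa(\rho)$ is the unique positive solution of $j(\kappa)=\rho\,c(\kappa)$. Suppose furthermore that there is a critical exponent $\beta$, i.e. for some $\alpha_0>0$, $c(\kappa(\rho))\sim\alpha_0(\rho-\rho_c)^\beta$ as $\rho\to\rho_c$, $\rho>\rho_c$, and that this estimate also holds at the level of the derivative: $$\frac{d\kappa}{d\rho}\sim n\,\alpha_0\,\beta\,(\rho-\rho_c)^{\beta-1}\quad\text{as }\rho\to\rho_c,\ \rho>\rho_c.$$ Then: (i) If $\beta<\frac12$, then $\Theta(\rho)<0$ if $\rho>\rho_c$ is sufficiently close to $\rho_c$; the SOH model is not hyperbolic. (ii) If $\beta>\frac12$, then $\Theta(\rho)>0$ if $\rho>\rho_c$ is sufficiently close to $\rho_c$; the SOH model is hyperbolic. (iii) If $\beta=\frac12$ and $\alpha_0\ne\sqrt{\frac{4(n+2)}{5n\rho_c}}$, then when $\rho>\rho_c$ is sufficiently close to $\rho_c$, $\Theta(\rho)$ has the sign of $\sqrt{\frac{4(n+2)}{5n\rho_c}}-\alpha_0$.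
   Context: Let $n\ge2$. The functions $\nu:[0,\infty)\to[0,\infty)$ and $\tau:[0,\infty)\to(0,\infty)$ are such that $r\mapsto\nu(r)/r$ and $r\mapsto\tau(r)$ are Lipschitz and bounded. $k=\nu/\tau$ is increasing, differentiable with Lipschitz derivative; $\kappa_{max}=\lim_{r\to\infty}k(r)$ and $j:[0,\kappa_{max})\to[0,\infty)$ is the inverse function of $k$. Let $c(\kappa)=\frac{\int_0^\pi\cos\theta\,e^{\kappa\cos\theta}\sin^{n-2}\theta\,d\theta}{\int_0^\pi e^{\kappa\cos\theta}\sin^{n-2}\theta\,d\theta}$, $\rho_c=\lim_{\kappa\to0}\frac{j(\kappa)}{c(\kappa)}$, and $$\widetilde c(\kappa)=\frac{\int_0^\pi\cos\theta\,h_\kappa(\cos\theta)\,e^{\kappa\cos\theta}\sin^n\theta\,d\theta}{\int_0^\pi h_\kappa(\cos\theta)\,e^{\kappa\cos\theta}\sin^n\theta\,d\theta},$$ where $h_\kappa>0$ on $[-1,1]$ is given by $h_\kappa(\cos\theta)=\frac{g_\kappa(\theta)}{\sin\theta}$, $g_\kappa$ being the unique solution in $V=\{g\,:\,(n-2)(\sin\theta)^{\frac n2-2}g\in L^2(0,\pi),\ (\sin\theta)^{\frac n2-1}g\in H^1_0(0,\pi)\}$ of $$-\sin^{2-n}\theta\,e^{-\kappa\cos\theta}\frac{d}{d\theta}\left(\sin^{n-2}\theta\,e^{\kappa\cos\theta}g'(\theta)\right)+\frac{n-2}{\sin^2\theta}g(\theta)=\sin\theta.$$ The self-organized hydrodynamic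 (SOH) model associated to a branch $\rho\mapsto\kappa(\rho)$ of solutions of $j(\kappa)=\rho\,c(\kappa)$ is the system for $\rho(x,t)>0$, $\Omega(x,t)\in\mathbb S$ (unit sphere of $\mathbb R^n$), $P_{\Omega^\perp}=\mathrm{Id}-\Omega\otimes\Omega$: $$\partial_t\rho+\nabla_x\cdot(\rho c_1\Omega)=0,\qquad \rho(\partial_t\Omega+c_2(\Omega\cdot\nabla_x)\Omega)+\Theta P_{\Omega^\perp}\nabla_x\rho=\mathcal K_2\,\delta\,P_{\Omega^\perp}\Delta_x(\rho c_1\Omega),$$ where $\mathcal K_2\ge0$ is a constant and, with $\kappa=\kappa(\rho)$, $c_1(\rho)=c(\kappa)$, $c_2(\rho)=\widetilde c(\kappa)$, $\Theta(\rho)=\frac1\kappa+(\widetilde c(\kappa)-c(\kappa))\frac\rho\kappa\frac{d\kappa}{d\rho}$, $\delta(\rho)=\frac{\nu(j(\kappa))}{c(\kappa)}\left(\frac{n-1}\kappa+\widetilde c(\kappa)\right)$. Hyperbolicity refers to the first-order part of the system; it is known that the SOH model is hyperbolic if and only if $\Theta>0$. *)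

(* Defs.v *)
From HB Require Import structures.
From mathcomp Require Export all_boot all_order all_algebra.
From mathcomp Require Export all_classical all_reals all_analysis.
Set Implicit Arguments.
Unset Strict Implicit.
Unset Printing Implicit Defensive.
Export Order.TTheory GRing.Theory Num.Theory.
Export numFieldNormedType.Exports.
Global Open Scope classical_set_scope.
Global Open Scope ring_scope.

Section FunctionSpaces.
Variable R : realType.
Implicit Types u v g dg phi : R -> R.

Notation I0pi := (`]0, (pi : R)[%classic).
Notation leb := (@lebesgue_measure R).

(* The functions are total on R; only their values on (0, pi) matter. *)
Definition L2_0pi u :=
  measurable_fun I0pi u /\ leb.-integrable I0pi (fun x => (u x ^+ 2)%:E).

Definition C1c_0pi phi :=
  [/\ forall x, derivable phi x 1, continuous (derive1 phi) &
      exists2 K : set R, compact K /\ K `<=` I0pi &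
                         forall x, ~ K x -> phi x = 0].

Definition weak_derivative_0pi u v :=
  [/\ locally_integrable I0pi u, locally_integrable I0pi v &
      forall phi, C1c_0pi phi ->
        \int[leb]_(x in I0pi) (u x * derive1 phi x) =
        - \int[leb]_(x in I0pi) (v x * phi x)].

(* H^1_0(0, pi) as the closure of C^1_c(0, pi) in H^1(0, pi); taking C^1
   rather than smooth functions gives the same closure. *)
Definition H10_0pi u :=
  L2_0pi u /\
  exists v, [/\ L2_0pi v, weak_derivative_0pi u v &
    exists phi : nat -> R -> R,
      [/\ forall m, C1c_0pi (phi m),
          \int[leb]_(x in I0pi) ((phi m x - u x) ^+ 2) @[m --> \oo] --> (0 : R) &
          \int[leb]_(x in I0pi) ((derive1 (phi m) x - v x) ^+ 2) @[m --> \oo]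
            --> (0 : R)]].

Definition in_V (n : nat) g :=
  L2_0pi (fun t => (n%:R - 2) * (sin t `^ (n%:R / 2 - 2)) * g t) /\
  H10_0pi (fun t => (sin t `^ (n%:R / 2 - 1)) * g t).

(* g is the variational (Lax-Milgram) solution in V of
     - sin^{2-n} e^{-k cos} (sin^{n-2} e^{k cos} g')' + (n-2) / sin^2 g = sin:
   the equation is multiplied by sin^{n-2} e^{k cos} f with f in V, and the
   first term is integrated by parts. *)
Definition solves_GCI (n : nat) (kap : R) g :=
  in_V n g /\
  exists2 dg, weak_derivative_0pi g dg &
  forall f df, in_V n f -> weak_derivative_0pi f df ->
    \int[leb]_(t in I0pi)
       (sin t ^+ (n - 2) * expR (kap * cos t) * (dg t * df t)) +
    \int[leb]_(t in I0pi)
       (sin t ^+ (n - 2) * expR (kap * cos t) *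
          ((n%:R - 2) / sin t ^+ 2 * g t * f t)) =
    \int[leb]_(t in I0pi)
       (sin t ^+ (n - 2) * expR (kap * cos t) * (sin t * f t)).

Definition order_c (n : nat) (kap : R) : R :=
  (\int[leb]_(t in `[0, pi]) (cos t * expR (kap * cos t) * sin t ^+ (n - 2))) /
  (\int[leb]_(t in `[0, pi]) (expR (kap * cos t) * sin t ^+ (n - 2))).

(* h kap stands for the function h_kap on [-1, 1]. *)
Definition ctilde (n : nat) (h : R -> R -> R) (kap : R) : R :=
  (\int[leb]_(t in `[0, pi])
     (cos t * h kap (cos t) * expR (kap * cos t) * sin t ^+ n)) /
  (\int[leb]_(t in `[0, pi])
     (h kap (cos t) * expR (kap * cos t) * sin t ^+ n)).

(* Derivative of f on the half-line [0, +oo[, one-sided at 0. *)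
Definition is_derivative_Rge0 (f f' : R -> R) :=
  forall r, 0 <= r ->
    (f s - f r) / (s - r) @[s --> within `[0, +oo[%classic r^'] --> f' r.

End FunctionSpaces.

(* First-order system d_t U + \sum_i (d_{x_i} U) *m A_i = 0, at a given state;
   U is a row vector taking values in a submanifold whose tangent space at that
   state is the row space of T.  Hyperbolicity: every symbol
   \sum_i xi_i A_i is diagonalizable over R on the tangent space. *)
Definition hyperbolic_symbol (R : realType) (n N : nat) (T : 'M[R]_N)
    (A : 'I_n -> 'M[R]_N) : Prop :=
  forall xi : 'rV[R]_n,
    let S := \sum_(i < n) xi 0 i *: A i in
    stablemx T S /\ diagonalizable (restrictmx T S).

Section SOH.
Variables (R : realType) (n : nat).

Definition unit_sphere : set 'rV[R]_n :=
  [set Om | \sum_(i < n) Om 0 i ^+ 2 = 1].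

Definition proj_orth (Om : 'rV[R]_n) : 'M[R]_n := 1%:M - Om^T *m Om.

(* Row space {(r, W) : r in R, W in R^n, W . Om = 0}, the tangent space of
   R x S at (rho, Om). *)
Definition soh_tangent (Om : 'rV[R]_n) : 'M[R]_(1 + n) :=
  kermx (col_mx (0 : 'M[R]_1) Om^T).

(* Coefficient of d_{x_i} (rho, Om) in the first-order part of
     d_t rho + div (rho c1 Om) = 0,
     rho (d_t Om + c2 (Om . grad) Om) + Theta P grad rho = K2 delta P Lap (rho c1 Om)
   (second equation divided by rho); rows: d_i rho and d_i Om, columns: the
   equations for rho and Om. *)
Definition soh_mx (c1 c2 Theta : R -> R) (rho : R) (Om : 'rV[R]_n)
    (i : 'I_n) : 'M[R]_(1 + n) :=
  block_mx ((derive1 (fun r => r * c1 r) rho * Om 0 i)%:M : 'M[R]_1)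
           ((Theta rho / rho) *: row i (proj_orth Om))
           ((rho * c1 rho) *: delta_mx i 0)
           (c2 rho * Om 0 i)%:M.

Definition soh_hyperbolic_at (c1 c2 Theta : R -> R) (rho : R)
    (Om : 'rV[R]_n) : Prop :=
  hyperbolic_symbol (soh_tangent Om) (soh_mx c1 c2 Theta rho Om).

(* Coefficients of the model along a branch kappa; h is the family h_kappa. *)
Definition soh_c1 (kappa : R -> R) (rho : R) : R := order_c n (kappa rho).

Definition soh_c2 (h : R -> R -> R) (kappa : R -> R) (rho : R) : R :=
  ctilde n h (kappa rho).

Definition soh_Theta (h : R -> R -> R) (kappa : R -> R) (rho : R) : R :=
  (kappa rho)^-1 +
  (ctilde n h (kappa rho) - order_c n (kappa rho)) * (rho / kappa rho)
    * derive1 kappa rho.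

End SOH.

(* Main.v *)
(* Testing the weak equation for [g] against [sin t * cos t ^ i], [i <= 2] (times
   a cutoff near the endpoints), gives linear relations between the moments
   [M i] of [g] with the weight [sin^(n-1) exp (kappa cos) cos^i].  Letting
   [kappa] tend to [0] they yield
     c~(kappa) = (2 n - 1) / (2 n (n + 2)) kappa + o(kappa),
   while [c(kappa) = kappa / n + o(kappa)] by integration by parts.  Hence
     kappa Theta = 1 - (5 / (2 n (n + 2)) + o(1)) rho kappa kappa',
   and [kappa kappa' ~ n^2 alpha0^2 beta (rho - rho_c)^(2 beta - 1)] tends to
   infinity, to [0] or to [n^2 alpha0^2 / 2] when [2 beta - 1] is negative,
   positive or zero.
   The symbol of the first-order part splits into a multiple of the identity and
   a 2 x 2 block with diagonal entries A, B and discriminant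
   [(A - B)^2 + 4 c1 Theta |P xi|^2]: it is annihilated by a polynomial with
   simple real roots when [Theta > 0], while for [xi] orthogonal to [Omega] its
   square has a negative eigenvalue when [Theta < 0]. *)
From mathcomp Require Import ring lra measurable_realfun.
Require Import Defs.
Set Implicit Arguments.
Unset Strict Implicit.
Unset Printing Implicit Defensive.

(** * Hyperbolicity *)

(** Only a variational solution in V is given: g comes with a weak derivative and no explicit
    boundary behaviour. For f compactly supported and w = sin^(n-2) exp(kappa cos), the function w
    f' is itself admissible in the definition of the weak derivative of g, so all derivatives move
    onto f. But sin cos^i is not compactly supported, and the cutoff leaves terms of size 1 / sin;
    they pass to the limit because g w / sin is integrable, which is what Hardy's inequality
    extracts from sin^(n/2-1) g lying in H^1_0. The three relations involve four moments, so they do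
    not close for fixed kappa. The surplus terms carry a factor kappa, and g >= 0 gives |M i| <= M
    0, while the first relation bounds M 0: no separate estimate of g uniform in kappa enters. Three
    facts behind the asymptotics have to be derived: kappa(rho) tends to 0 (j / c is increasing),
    rho_c > 0 (k has a finite slope at 0), and beta > 0 (c(kappa(rho)) tends to 0). *)

Lemma diagonalizable_restrict (F : fieldType) (N : nat) (T S : 'M[F]_N.+1)
    (rs : seq F) :
  stablemx T S -> uniq rs ->
  T *m horner_mx S (\prod_(x <- rs) ('X - x%:P)) = 0 ->
  diagonalizable (restrictmx T S).
Proof.
move=> TS urs T0.
have V0 : row_base T *m horner_mx S (\prod_(x <- rs) ('X - x%:P)) = 0.
  apply/eqP; rewrite -submx0; apply: submx_trans (submxMr _ _) _.
    by rewrite eq_row_base.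
  by rewrite T0 sub0mx.
have Vf := row_base_free T.
have VS : stablemx (row_base T) S by rewrite stablemx_row_base.
(* Minimal polynomials concern nonempty matrices, so rank zero is split off; there any matrix is
   diagonal. Otherwise the minimal polynomial of the restriction divides a product of distinct
   linear factors. *)
move: (row_base T) Vf VS V0; case: (\rank T) => [|m] V Vf VS V0.
  exists 1%:M; rewrite ?unitmx1// /similar_to.
  by apply/is_diag_mxP => -[].
apply/diagonalizableP; exists rs => //; apply: mxminpoly_min.
by rewrite horner_mx_conj// /conjmx V0 mul0mx.
Qed.

(** In an eigenbasis the square acts by the numbers d_i^2 >= 0, so each coordinate w_i of [v]
    satisfies (d_i^2 - mu) w_i = 0 and vanishes. No complex eigenvalue has to be exhibited. *)
Lemma diagonalizable_no_neg_square (F : realFieldType) (N : nat)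
    (T S : 'M[F]_N) (v : 'rV[F]_N) (mu : F) :
  stablemx T S -> (v <= T)%MS -> v != 0 -> mu < 0 ->
  v *m S *m S = mu *: v -> ~ diagonalizable (restrictmx T S).
Proof.
move=> TS vT v0 mu0 vSS [P Pu /similar_diagPex[d /similarPp]].
rewrite stablemx_unit// => /(_ isT) PD.
have VS : stablemx (row_base T) S by rewrite stablemx_row_base.
have [w vE] : exists w, v = w *m P *m row_base T.
  have /submxP[w ->] : (v <= row_base T)%MS by rewrite eq_row_base.
  by exists (w *m invmx P); rewrite mulmxKV.
have wS (u : 'rV_(\rank T)) :
    u *m P *m row_base T *m S = u *m diag_mx d *m P *m row_base T.
  have VE : row_base T *m S = restrictmx T S *m row_base T.
    by rewrite /conjmx mulmxKpV.
  by rewrite -(mulmxA _ _ S) VE mulmxA -(mulmxA u P) PD !mulmxA.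
have wE : w *m diag_mx d *m diag_mx d = mu *: w.
  apply: (can_inj (mulmxK Pu)); apply: (row_free_inj (row_base_free T)).
  by rewrite -!wS -vE vSS vE -!scalemxAl.
case/eqP: v0; rewrite vE (_ : w = 0) ?mul0mx//.
apply/rowP => i; move/rowP/(_ i): wE; rewrite !mul_mx_diag !mxE => wi.
apply/eqP; have d0 := sqr_ge0 (d 0 i).
have /eqP : (d 0 i ^+ 2 - mu) * w 0 i = 0 by rewrite mulrBl -wi; ring.
rewrite mulf_eq0 => /orP[/eqP dmu|//].
suff : 0 < d 0 i ^+ 2 - mu by rewrite dmu ltxx.
by rewrite subr_gt0 (lt_le_trans mu0).
Qed.

(** * The symbol acting on tangent vectors *)

Section Symbol.
Variables (R : realType) (n : nat).
Implicit Types (Om xi W : 'rV[R]_n).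

Lemma row_sqnorm_ge0 W : 0 <= (W *m W^T) 0 0.
Proof. by rewrite mxE; apply: sumr_ge0 => i _; rewrite mxE -expr2 sqr_ge0. Qed.

Lemma row_sqnorm_eq0 W : (W *m W^T) 0 0 = 0 -> W = 0.
Proof.
rewrite mxE => /eqP; rewrite psumr_eq0; last first.
  by move=> i _; rewrite mxE -expr2 sqr_ge0.
move=> /allP H; apply/rowP => i; rewrite mxE; apply/eqP.
by rewrite -sqrf_eq0; have := H i (mem_index_enum _); rewrite mxE expr2.
Qed.

Lemma unit_sphere_mul Om : unit_sphere Om -> Om *m Om^T = 1%:M.
Proof.
move=> O1; apply/matrixP => i j; rewrite !ord1 !mxE/= -O1.
by apply: eq_bigr => k _; rewrite mxE expr2.
Qed.

Lemma soh_tangentP Om (r : 'M[R]_1) W :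
  (row_mx r W <= soh_tangent Om)%MS = (W *m Om^T == 0).
Proof.
by rewrite /soh_tangent; apply/sub_kermxP/eqP; rewrite mul_row_col mulmx0 add0r.
Qed.

Lemma soh_symbolE c1 c2 Theta rho Om xi :
  \sum_(i < n) xi 0 i *: soh_mx c1 c2 Theta rho Om i =
  block_mx ((derive1 (fun r => r * c1 r) rho) *: (xi *m Om^T))
     ((Theta rho / rho) *: (xi *m proj_orth Om))
     ((rho * c1 rho) *: xi^T) (c2 rho * (xi *m Om^T) 0 0)%:M.
Proof.
rewrite /soh_mx; set D := derive1 _ _.
under eq_bigr do rewrite scale_block_mx.
have -> (F1 : 'I_n -> 'M[R]_1) F2 F3 (F4 : 'I_n -> 'M[R]_n) :
  \sum_i block_mx (F1 i) (F2 i) (F3 i) (F4 i) =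
  block_mx (\sum_i F1 i) (\sum_i F2 i) (\sum_i F3 i) (\sum_i F4 i).
  apply/matrixP => i j; rewrite summxE.
  case: (split_ordP i) => i' ->; case: (split_ordP j) => j' ->.
  - by rewrite block_mxEul summxE; apply: eq_bigr => k _; rewrite block_mxEul.
  - by rewrite block_mxEur summxE; apply: eq_bigr => k _; rewrite block_mxEur.
  - by rewrite block_mxEdl summxE; apply: eq_bigr => k _; rewrite block_mxEdl.
  - by rewrite block_mxEdr summxE; apply: eq_bigr => k _; rewrite block_mxEdr.
congr block_mx.
- apply/matrixP => i j; rewrite summxE !ord1 !mxE mulr_sumr.
  by apply: eq_bigr => k _; rewrite !mxE eqxx mulr1n; ring.
- apply/rowP => j; rewrite summxE !mxE mulr_sumr.
  by apply: eq_bigr => k _; rewrite !mxE; ring.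
- apply/colP => j; rewrite summxE !mxE (bigD1 j)//= big1 ?addr0.
    by rewrite !mxE !eqxx mulr1 mulrC.
  by move=> k kj; rewrite !mxE eq_sym (negbTE kj) /= mulr0 mulr0.
- apply/matrixP => i j; rewrite summxE !mxE.
  rewrite mulr_sumr -sumrMnl; apply: eq_bigr => k _; rewrite !mxE.
  by rewrite mulrnAr; congr (_ *+ _); ring.
Qed.

Lemma proj_orth_sym Om : (proj_orth Om)^T = proj_orth Om.
Proof. by rewrite /proj_orth linearB/= trmx1 trmx_mul trmxK. Qed.

Lemma mul_proj_orth Om W : W *m Om^T = 0 -> W *m proj_orth Om = W.
Proof. by move=> W0; rewrite mulmxBr mulmx1 mulmxA W0 mul0mx subr0. Qed.

Lemma proj_orth_mul Om : unit_sphere Om -> proj_orth Om *m Om^T = 0.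
Proof.
by move=> O1; rewrite mulmxBl mul1mx -mulmxA unit_sphere_mul// mulmx1 subrr.
Qed.

(** As W is orthogonal to Omega, W . xi = W . p: on tangent vectors the symbol depends on xi only
    through a = xi . Omega and the projection p. This reduces the diagonalization to a 2 x 2
    problem. *)
Lemma soh_symbol_row c1 c2 Theta rho Om xi (x : R) W :
  let a := (xi *m Om^T) 0 0 in
  let p := xi *m proj_orth Om in
  W *m Om^T = 0 ->
  row_mx x%:M W *m \sum_(i < n) xi 0 i *: soh_mx c1 c2 Theta rho Om i =
  row_mx (derive1 (fun r => r * c1 r) rho * a * x +
          rho * c1 rho * (W *m p^T) 0 0)%:M
         ((Theta rho / rho * x) *: p + (c2 rho * a) *: W).
Proof.
move=> a p W0; rewrite soh_symbolE mul_row_block; congr row_mx; last first.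
  by rewrite mul_scalar_mx scalerA mulrC mul_mx_scalar.
have -> : W *m p^T = W *m xi^T.
  by rewrite trmx_mul proj_orth_sym mulmxA mul_proj_orth.
rewrite (mx11_scalar (xi *m Om^T)) -/a -scalemxAr mul_scalar_mx -scalemxAr.
rewrite (mx11_scalar (W *m xi^T)) !scale_scalar_mx -raddfD /=.
by congr (_%:M); rewrite [_%:M 0 0]mxE mulr1n; ring.
Qed.

Section Hyperbolicity.
Variables (c1 c2 Theta : R -> R) (rho : R) (Om : 'rV[R]_n).
Hypotheses (rho0 : 0 < rho) (c10 : 0 < c1 rho) (Om1 : unit_sphere Om).

Let T := soh_tangent Om.
Let S xi := \sum_(i < n) xi 0 i *: soh_mx c1 c2 Theta rho Om i.

Lemma soh_stable xi : stablemx T (S xi).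
Proof.
apply/row_subP => i; rewrite row_mul; set v := row i T.
have : (v <= T)%MS by exact: row_sub.
rewrite -(hsubmxK v) soh_tangentP => /eqP W0.
rewrite (mx11_scalar (lsubmx v)) /S soh_symbol_row// soh_tangentP.
by rewrite mulmxDl -!scalemxAl W0 -mulmxA proj_orth_mul// mulmx0 !scaler0 addr0.
Qed.

(** The factor S - B sends every tangent vector into the span of (1, 0) and (0, p). On that
    invariant space the symbol is a 2 x 2 matrix, with roots l1 and l2. *)
Lemma soh_hyperbolic_gt0 :
  0 < Theta rho -> soh_hyperbolic_at c1 c2 Theta rho Om.
Proof.
move=> Th0 xi /=; rewrite -/(S xi) -/T; split; first exact: soh_stable.
pose a := (xi *m Om^T) 0 0; pose p := xi *m proj_orth Om.
pose A := derive1 (fun r => r * c1 r) rho * a; pose B := c2 rho * a.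
pose k := Theta rho / rho; pose m := rho * c1 rho.
pose s := (p *m p^T) 0 0.
have s0 : 0 <= s by exact: row_sqnorm_ge0.
have p0 : p *m Om^T = 0 by rewrite -mulmxA proj_orth_mul// mulmx0.
have rowT (v : 'rV[R]_(1 + n)) : (v <= T)%MS ->
    exists x W, W *m Om^T = 0 /\ v = row_mx x%:M W.
  rewrite -{1}(hsubmxK v) soh_tangentP => /eqP W0.
  by exists (lsubmx v 0 0), (rsubmx v); rewrite -mx11_scalar hsubmxK.
have rowS x W l : W *m Om^T = 0 -> row_mx x%:M W *m (S xi - l%:M) =
    row_mx ((A - l) * x + m * (W *m p^T) 0 0)%:M
       ((k * x) *: p + (B - l) *: W).
  move=> W0; rewrite mulmxBr soh_symbol_row// mul_mx_scalar scale_row_mx.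
  rewrite opp_row_mx add_row_mx scale_scalar_mx -raddfB/= scalerBl addrA.
  by congr (row_mx _%:M _); rewrite -/a -/p -/A -/m; ring.
have hS l : horner_mx (S xi) ('X - l%:P) = S xi - l%:M.
  by rewrite rmorphB/= horner_mx_X horner_mx_C.
have rowST (M : 'M[R]_(1 + n)) :
   (forall x W, W *m Om^T = 0 -> row_mx x%:M W *m M = 0) -> T *m M = 0.
  move=> H; apply/row_matrixP => i; rewrite row_mul row0.
  have [|x [W [W0 ->]]] := rowT (row i T); first exact: row_sub.
  by rewrite H.
(* If p = 0, the symbol is A on the density and B on the orientation, and the three generic roots
   collide; the list of roots is then [A] or [A; B]. *)
have [s_eq0|s_neq0] := eqVneq s 0.
  have pz : p = 0 by exact: row_sqnorm_eq0.
  have [AB|AB] := eqVneq A B.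
    apply: (@diagonalizable_restrict _ _ _ _ [:: A]) => //.
      exact: soh_stable.
    rewrite big_cons big_nil mulr1 hS; apply: rowST => x W W0.
    rewrite rowS// pz trmx0 mulmx0 scaler0 mxE AB subrr scale0r mul0r mulr0.
    by rewrite !addr0 raddf0 row_mx0.
  apply: (@diagonalizable_restrict _ _ _ _ [:: A; B]).
  - exact: soh_stable.
  - by rewrite /= inE AB.
  - rewrite 2!big_cons big_nil mulr1 rmorphM /= !hS; apply: rowST => x W W0.
    rewrite [_ * _]/(_ *m _) mulmxA rowS// pz trmx0 mulmx0 scaler0 mxE mulr0.
    rewrite subrr mul0r !addr0 add0r rowS ?pz ?trmx0 ?mulmx0 ?mxE.
      by rewrite !mulr0 addr0 scaler0 subrr scale0r addr0 raddf0 row_mx0.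
    by rewrite -scalemxAl W0 scaler0.
have ks : 0 < k * m * s.
  by rewrite /k /m !mulr_gt0 ?invr_gt0// lt_neqAle eq_sym s_neq0.
pose D := (A - B) ^+ 2 + 4 * (k * m * s).
have D0 : 0 < D by rewrite ltr_wpDl ?sqr_ge0// mulr_gt0.
pose q := Num.sqrt D.
have qD : q ^+ 2 = D by rewrite sqr_sqrtr// ltW.
have q0 : 0 < q by rewrite sqrtr_gt0.
pose l1 := (A + B + q) / 2; pose l2 := (A + B - q) / 2.
have l1E : (A - l1) * (B - l1) = k * m * s.
  rewrite /l1 (_ : _ * _ = (q ^+ 2 - (A - B) ^+ 2) / 4); last by field.
  by rewrite qD /D; field.
have l2E : (A - l2) * (B - l2) = k * m * s.
  rewrite /l2 (_ : _ * _ = (q ^+ 2 - (A - B) ^+ 2) / 4); last by field.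
  by rewrite qD /D; field.
have l12 : A + B = l1 + l2 by rewrite /l1 /l2; field.
apply: (@diagonalizable_restrict _ _ _ _ [:: B; l1; l2]).
- exact: soh_stable.
(* B cannot be l1 or l2, since (A - l) (B - l) = k m s is positive at both; l1 and l2 differ by q >
   0. *)
- rewrite /= !inE andbT negb_or -andbA; apply/and3P; split.
  + by apply/eqP => Bl; move: l1E ks; rewrite -Bl subrr mulr0 => <-; rewrite ltxx.
  + by apply/eqP => Bl; move: l2E ks; rewrite -Bl subrr mulr0 => <-; rewrite ltxx.
  + by apply/eqP; rewrite /l1 /l2 => l; move: q0; lra.
- rewrite 3!big_cons big_nil mulr1 !(rmorphM (horner_mx (S xi))) /= !hS.
  apply: rowST => x W W0.
  (* Row vectors meet S - B first, which leaves a vector of the form (y, z p); the other two factors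
     are then Cayley-Hamilton for the 2 x 2 block. *)
  rewrite [_ * _]/(_ *m (_ *m _)) !mulmxA rowS// subrr scale0r addr0.
  move: (_ + _) (k * x) => y z; rewrite rowS -?scalemxAl ?p0 ?scaler0// mxE -/s.
  rewrite scalerA -scalerDl rowS -?scalemxAl ?p0 ?scaler0// mxE -/s scalerA.
  rewrite -scalerDl.
  have -> : (A - l2) * ((A - l1) * y + m * (z * s)) +
       m * ((k * y + (B - l1) * z) * s) = 
    ((A - l2) * (A - l1) + k * m * s) * y +
    (A + B - (l1 + l2)) * (m * z * s) by ring.
  have -> : k * ((A - l1) * y + m * (z * s)) + (B - l2) * (k * y + (B - l1) * z)
     = (A + B - (l1 + l2)) * k * y + ((B - l2) * (B - l1) + k * m * s) * z by ring.
  rewrite l12 subrr !mul0r addr0 add0r.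
  have -> : B = l1 + l2 - A by rewrite -l12; ring.
  have -> : (A - l2) * (A - l1) + k * m * s = 0.
    by rewrite -l1E (_ : B = l1 + l2 - A); [ring|rewrite -l12; ring].
  have -> : (l1 + l2 - A - l2) * (l1 + l2 - A - l1) + k * m * s = 0.
    by rewrite -l1E (_ : B = l1 + l2 - A); [ring|rewrite -l12; ring].
  by rewrite !mul0r scale0r raddf0 row_mx0.
Qed.

Lemma soh_hyperbolic_lt0 : (2 <= n)%N ->
  Theta rho < 0 -> ~ soh_hyperbolic_at c1 c2 Theta rho Om.
Proof.
move=> n2 Th0 hyp.
(* Such a direction exists because [Om^T] has rank at most 1 < n; it makes both diagonal entries
   vanish. *)
have [xi xi0 xiO] : exists2 xi : 'rV[R]_n, xi != 0 & xi *m Om^T = 0.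
  have : kermx Om^T != 0.
    rewrite -mxrank_eq0 mxrank_ker subn_eq0 -ltnNge.
    by rewrite (leq_ltn_trans (rank_leq_col _)).
  by move=> /rowV0Pn[xi /sub_kermxP]; exists xi.
pose s := (xi *m xi^T) 0 0.
have s0 : 0 < s.
  rewrite lt_neqAle row_sqnorm_ge0 andbT eq_sym.
  by apply: contra xi0 => /eqP/row_sqnorm_eq0 ->.
have [] := hyp xi; rewrite -/T -/(S xi) => TS.
have v0 : row_mx (1%:M : 'M[R]_1) (0 : 'rV[R]_n) != 0.
  apply/eqP => /rowP/(_ (lshift n 0)); rewrite row_mxEl !mxE eqxx => /eqP.
  by rewrite oner_eq0.
(* A pure density perturbation (1, 0) is sent to (0, (Theta / rho) xi), and back to (Theta c1
   |xi|^2, 0). *)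
apply: (@diagonalizable_no_neg_square _ _ _ _ (row_mx 1%:M 0)
   (Theta rho * c1 rho * s)) => //.
- by rewrite soh_tangentP mul0mx.
- by rewrite pmulr_llt0// pmulr_llt0.
- rewrite /S soh_symbol_row ?mul0mx// soh_symbol_row; last first.
    rewrite mulmxDl -!scalemxAl -mulmxA proj_orth_mul//.
    by rewrite mul0mx mulmx0 !scaler0 addr0.
  rewrite mul_proj_orth// xiO scaler0 addr0 -scalemxAl !mxE.
  rewrite scale_row_mx !mulr0 !mul0r !add0r scale0r addr0 scale_scalar_mx scaler0.
  rewrite !mulr0 scale0r !mulr1; congr (row_mx _%:M _).
  rewrite /s mxE; field; exact: lt0r_neq0.
Qed.

End Hyperbolicity.
End Symbol.

(** * Derivation and continuity tactics *)

Section Calculus.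
Variable R : realType.
Implicit Types f g : R -> R.

(** This lemma and its companions restate the rules with the operation visible under a binder, so
    that the tactics can choose a rule by matching on the goal. *)
Lemma is_derive_addf f g (x df dg : R) :
  is_derive x 1 f df -> is_derive x 1 g dg ->
  is_derive x 1 (fun y => f y + g y) (df + dg).
Proof. by move=> ? ?; exact: is_deriveD. Qed.

Lemma is_derive_subf f g (x df dg : R) :
  is_derive x 1 f df -> is_derive x 1 g dg ->
  is_derive x 1 (fun y => f y - g y) (df - dg).
Proof. by move=> ? ?; exact: is_deriveB. Qed.

Lemma is_derive_oppf f (x df : R) :
  is_derive x 1 f df -> is_derive x 1 (fun y => - f y) (- df).
Proof. by move=> ?; exact: is_deriveN. Qed.

Lemma is_derive_mulf f g (x df dg : R) :
  is_derive x 1 f df -> is_derive x 1 g dg ->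
  is_derive x 1 (fun y => f y * g y) (df * g x + f x * dg).
Proof.
move=> ? ?; apply: (is_derive_eq (is_deriveM _ _)).
by rewrite /GRing.scale/= addrC mulrC (mulrC df).
Qed.

Lemma is_derive_compf f g (x df dg : R) :
  is_derive (g x) 1 f df -> is_derive x 1 g dg ->
  is_derive x 1 (fun y => f (g y)) (df * dg).
Proof. by move=> ? ?; exact: is_derive1_comp. Qed.

Lemma is_derive_exprf f n (x df : R) :
  is_derive x 1 f df ->
  is_derive x 1 (fun y => f y ^+ n) (n%:R * f x ^+ n.-1 * df).
Proof.
move=> fx; rewrite (_ : (fun y => _) = f ^+ n).
  exact: is_deriveX.
by apply/funext => y; rewrite exprfctE.
Qed.

Lemma is_derive_invf f (x df : R) : f x != 0 ->
  is_derive x 1 f df -> is_derive x 1 (fun y => (f y)^-1) (- f x ^- 2 * df).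
Proof. by move=> fx0 ?; exact: is_deriveV. Qed.

Lemma is_derive_val f (x df df' : R) :
  is_derive x 1 f df -> df = df' -> is_derive x 1 f df'.
Proof. by move=> fx <-. Qed.

Lemma is_derive_continuous f (x df : R) :
  is_derive x 1 f df -> continuous_at x f.
Proof.
by move=> [fx _]; apply/differentiable_continuous/derivable1_diffP.
Qed.

Lemma is_derive1E f (x df : R) : is_derive x 1 f df -> derive1 f x = df.
Proof. by move=> [_ <-]; rewrite derive1E. Qed.

Lemma continuous_at_addf f g (x : R) :
  continuous_at x f -> continuous_at x g ->
  continuous_at x (fun y => f y + g y).
Proof. by move=> cf cg; exact: cvgD. Qed.

Lemma continuous_at_subf f g (x : R) :
  continuous_at x f -> continuous_at x g ->
  continuous_at x (fun y => f y - g y).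
Proof. by move=> cf cg; exact: cvgB. Qed.

Lemma continuous_at_oppf f (x : R) :
  continuous_at x f -> continuous_at x (fun y => - f y).
Proof. by move=> cf; exact: cvgN. Qed.

Lemma continuous_at_mulf f g (x : R) :
  continuous_at x f -> continuous_at x g ->
  continuous_at x (fun y => f y * g y).
Proof. by move=> cf cg; exact: cvgM. Qed.

Lemma continuous_at_compf f g (x : R) :
  continuous f -> continuous_at x g -> continuous_at x (fun y => f (g y)).
Proof. by move=> cf cg; exact: (continuous_comp cg (cf _)). Qed.

Lemma continuous_at_exprf f n (x : R) :
  continuous_at x f -> continuous_at x (fun y => f y ^+ n).
Proof. exact: (continuous_at_compf (@exprn_continuous _ n)). Qed.

Lemma continuous_at_invf f (x : R) : f x != 0 ->
  continuous_at x f -> continuous_at x (fun y => (f y)^-1).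
Proof. by move=> fx cf; exact: cvgV. Qed.

End Calculus.

(** [notypeclasses refine] keeps instance resolution from choosing the shape of
    the derivative. *)
Ltac derive_step := lazymatch goal with
  | |- is_derive ?x _ (fun _ => ?c) _ => exact: is_derive_cst
  | |- is_derive ?x _ (fun y => @?f y + - (@?g y)) _ =>
      notypeclasses refine (@is_derive_subf _ f g x _ _ _ _); derive_step
  | |- is_derive ?x _ (fun y => @?f y + @?g y) _ =>
      notypeclasses refine (@is_derive_addf _ f g x _ _ _ _); derive_step
  | |- is_derive ?x _ (fun y => - (@?f y)) _ =>
      notypeclasses refine (@is_derive_oppf _ f x _ _); derive_step
  | |- is_derive ?x _ (fun y => @?f y * @?g y) _ =>
      notypeclasses refine (@is_derive_mulf _ f g x _ _ _ _); derive_step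
  | |- is_derive ?x _ (fun y => @?f y ^+ ?n) _ =>
      notypeclasses refine (@is_derive_exprf _ f n x _ _); derive_step
  | |- is_derive ?x _ (fun y => (@?f y)^-1) _ =>
      notypeclasses refine (@is_derive_invf _ f x _ _ _); [ | derive_step]
  | |- is_derive ?x _ (fun y => expR (@?f y)) _ =>
      notypeclasses refine (@is_derive_compf _ _ f x _ _ (is_derive_expR _) _);
      derive_step
  | |- is_derive ?x _ (fun y => sin y) _ => exact: is_derive_sin
  | |- is_derive ?x _ (fun y => cos y) _ => exact: is_derive_cos
  | |- is_derive ?x _ (fun y => y) _ => exact: is_derive_id
  | _ : context [is_derive _ _ ?f _] |- is_derive _ _ (fun y => ?f y) _ => eauto
  | |- _ => idtac
  end.

Ltac derivef :=
  notypeclasses refine (is_derive_val _ _);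
  [ derive_step; cbv beta | cbv beta ].

Ltac contf := lazymatch goal with
  | |- continuous_at ?x (fun _ => ?c) => exact: cvg_cst
  | |- continuous_at ?x (fun y => @?f y + - (@?g y)) =>
      refine (@continuous_at_subf _ f g x _ _); contf
  | |- continuous_at ?x (fun y => @?f y + @?g y) =>
      refine (@continuous_at_addf _ f g x _ _); contf
  | |- continuous_at ?x (fun y => - (@?f y)) =>
      refine (@continuous_at_oppf _ f x _); contf
  | |- continuous_at ?x (fun y => @?f y * @?g y) =>
      refine (@continuous_at_mulf _ f g x _ _); contf
  | |- continuous_at ?x (fun y => @?f y ^+ ?n) =>
      refine (@continuous_at_exprf _ f n x _); contf
  | |- continuous_at ?x (fun y => (@?f y)^-1) =>
      refine (@continuous_at_invf _ f x _ _); [ | contf]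
  | |- continuous_at ?x (fun y => expR (@?f y)) =>
      refine (@continuous_at_compf _ _ f x (@continuous_expR _) _); contf
  | |- continuous_at ?x (fun y => sin y) => exact: continuous_sin
  | |- continuous_at ?x (fun y => cos y) => exact: continuous_cos
  | |- continuous_at ?x sin => exact: continuous_sin
  | |- continuous_at ?x cos => exact: continuous_cos
  | |- continuous_at ?x (fun y => y) => exact: cvg_id
  | |- continuous_at ?x (fun y => ?f y) =>
      change (continuous_at x f); try assumption
  | |- _ => try assumption
  end.

(** * Compactly supported functions on (0, pi) *)

Section TestFunctions.
Variable R : realType.
Implicit Types (f g u v phi psi : R -> R) (x t s e : R).
Notation I0pi := (`]0, (pi : R)[%classic).
Notation leb := (@lebesgue_measure R).

Lemma continuous_integrable_0pi f : continuous f ->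
  leb.-integrable I0pi (EFin \o f).
Proof.
move=> cf; apply: (@integrableS _ _ _ leb `[(0:R), pi]%classic) => //.
  by apply: subset_itv_oo_cc.
apply: continuous_compact_integrable; first exact: segment_compact.
exact: continuous_subspaceT.
Qed.

Lemma Rintegral_0pi_closed f : continuous f ->
  \int[leb]_(t in `[0, pi]) f t = \int[leb]_(t in I0pi) f t.
Proof.
move=> cf; have if0 := continuous_integrable_0pi cf.
rewrite -Rintegral_itv_obnd_cbnd ?Rintegral_itv_bndo_bndc//.
apply: (@integrableS _ _ _ leb `[(0:R), pi]%classic) => //.
  by apply: subset_itvr; rewrite bnd_simp.
apply: continuous_compact_integrable; first exact: segment_compact.
exact: continuous_subspaceT.
Qed.

Lemma Rintegral_0pi_derive (F f : R -> R) :
  (forall x : R, is_derive x 1 F (f x)) -> continuous f ->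
  \int[leb]_(t in I0pi) f t = F pi - F 0.
Proof.
move=> Ff cf; rewrite -Rintegral_0pi_closed// /Rintegral.
rewrite (@continuous_FTC2 _ f F)//.
- exact: pi_gt0.
- exact: continuous_subspaceT.
- have cF x : {for x, continuous F} by exact: is_derive_continuous (Ff x).
  split.
  + by move=> x _; have [] := Ff x.
  + exact/cvg_at_right_filter/cF.
  + exact/cvg_at_left_filter/cF.
- by move=> x _; exact: is_derive1E.
Qed.

Lemma C1c_continuous phi : C1c_0pi phi -> continuous phi.
Proof.
by move=> [d _ _] x; apply: is_derive_continuous; apply: derivableP.
Qed.

Lemma C1c_is_derive phi x : C1c_0pi phi -> is_derive x 1 phi (derive1 phi x).
Proof. by move=> [d _ _]; rewrite derive1E; apply: derivableP. Qed.

Lemma C1c_out phi x : C1c_0pi phi -> ~ (0 < x < pi) -> phi x = 0.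
Proof.
move=> [_ _ [K [cK KI] phiK]] x0; apply: phiK => /KI /=.
by rewrite in_itv /=.
Qed.

(** The image of the compact support under sin is closed and misses 0. Distance to the endpoints is
    measured by sin because all weights and cutoffs are functions of sin. *)
Lemma C1c_support phi : C1c_0pi phi ->
  exists2 e : R, 0 < e & forall t, sin t <= e -> phi t = 0.
Proof.
move=> [_ _ [K [cK KI] phiK]].
have cS : closed (sin @` K).
  apply: compact_closed; first exact: Rhausdorff.
  apply: continuous_compact => //.
  by apply: continuous_subspaceT; exact: continuous_sin.
have : (~` (sin @` K)) (0 : R).
  move=> [t /KI]; rewrite /= in_itv /= => /sin_gt0_pi.
  by move=> + t0; rewrite t0 ltxx.
move=> nK; have /nbhs_ballP[e /= e0 eK] : nbhs (0 : R) (~` (sin @` K)).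
  by apply: open_nbhs_nbhs; split => //; exact: closed_openC.
exists (e / 2); first by rewrite divr_gt0.
move=> t te; apply: phiK => Kt.
have /sin_gt0_pi t0 : 0 < t < pi by have := KI _ Kt; rewrite /= in_itv.
have := eK (sin t); apply; last by exists t.
rewrite /ball /= sub0r normrN gtr0_norm// (le_lt_trans te)//.
by rewrite ltr_pdivrMr// ltr_pMr// ltr1n.
Qed.

(** [C1c_0pi] concerns functions on the whole line, whereas formulas containing 1 / sin t are
    controlled only inside (0, pi). *)
Definition ext0pi f t : R := if 0 < t < pi then f t else 0.

Lemma near_0pi t : 0 < t < pi -> \forall s \near t, 0 < s < pi.
Proof.
move=> t0; have : t \in `]0, pi[ by rewrite in_itv.
by move/near_in_itvoo; apply: filterS => s; rewrite in_itv.
Qed.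

Lemma ext0pi_near_out f e t : 0 < e ->
  (forall s, 0 < s < pi -> sin s <= e -> f s = 0) ->
  ~ (0 < t < pi) -> \forall s \near t, ext0pi f s = 0.
Proof.
move=> e0 f0 t0; pose sg (s : R) := sin (Num.max 0 (Num.min s pi)).
have sgE s : 0 < s < pi -> sg s = sin s.
  move=> /andP[s0 spi]; rewrite /sg min_l ?ltW// max_r ?ltW//.
have sgt : sg t = 0.
  rewrite /sg; move/negP: t0; rewrite negb_and -!leNgt => /orP[t0|t0].
    by rewrite max_l ?sin0// ge_min t0.
  by rewrite min_r// max_r ?sinpi// pi_ge0.
have csg : {for t, continuous sg}.
  apply: continuous_comp; last exact: continuous_sin.
  apply: (@continuous_max _ _ (cst 0) (fun s => Num.min s pi)).
    exact: cst_continuous.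
  by apply: (@continuous_min _ _ id (cst pi)); [exact: cvg_id|exact: cst_continuous].
have : \forall s \near t, sg s < e.
  by apply: (cvgr_lt _ csg); rewrite sgt.
apply: filterS => s se; rewrite /ext0pi; case: ifPn => // s0.
by apply: f0 => //; rewrite -sgE// ltW.
Qed.

(** The source of all test functions below: it suffices to differentiate a formula inside (0, pi)
    and to know that it vanishes near the endpoints. *)
Lemma C1c_ext f df e : 0 < e ->
  (forall s, 0 < s < pi -> is_derive s 1 f (df s)) ->
  (forall s, 0 < s < pi -> continuous_at s df) ->
  (forall s, 0 < s < pi -> sin s <= e -> f s = 0) ->
  C1c_0pi (ext0pi f) /\ forall t, derive1 (ext0pi f) t = ext0pi df t.
Proof.
move=> e0 fdf cdf f0.
have H t : is_derive t 1 (ext0pi f) (ext0pi df t).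
  rewrite {2}/ext0pi; case: ifPn => [t0|/negP t0].
    apply: (@near_eq_is_derive _ _ _ f); last exact: fdf.
    by apply: filterS (near_0pi t0) => s s0; rewrite /ext0pi s0.
  apply: (@near_eq_is_derive _ _ _ (cst 0)).
  by apply: filterS (ext0pi_near_out e0 f0 t0) => s ->.
have dE t : derive1 (ext0pi f) t = ext0pi df t by exact: is_derive1E.
(* Where sin s <= e / 2, the inequality sin < e holds on a neighbourhood, so [f] vanishes there and
   so does its derivative. *)
have e20 : 0 < e / 2 by rewrite divr_gt0.
have df0 s : 0 < s < pi -> sin s <= e / 2 -> df s = 0.
  move=> s0 se; have -> : df s = ext0pi df s by rewrite /ext0pi s0.
  rewrite -dE; apply: is_derive1E.
  apply: (@near_eq_is_derive _ _ _ (cst 0)).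
  have : \forall u \near s, sin u < e.
    apply: (cvgr_lt _ (@continuous_sin R s)).
    by rewrite (le_lt_trans se)// ltr_pdivrMr// ltr_pMr// ltr1n.
  apply: filterS => u /ltW ue; rewrite /ext0pi; case: ifPn => // u0.
  by rewrite f0.
split=> //; split.
- by move=> t; have [] := H t.
- have -> : derive1 (ext0pi f) = ext0pi df by apply/funext.
  move=> t; have [t0|/negP t0] := boolP (0 < t < pi).
    have tE : ext0pi df t = df t by rewrite /ext0pi t0.
    rewrite /continuous_at tE; apply: cvg_trans (cdf _ t0).
    apply: near_eq_cvg.
    by apply: filterS (near_0pi t0) => s s0; rewrite /ext0pi s0.
  have := ext0pi_near_out e20 df0 t0 => nt.
  have tE : ext0pi df t = 0 by exact: nbhs_singleton nt.
  by rewrite /continuous_at tE; exact: cvg_near_cst.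
- exists (`[0, pi]%classic `&` [set t | e <= sin t]).
    split.
      apply: (@subclosed_compact _ _ `[0, pi]%classic).
      - apply: closedI; first exact: itv_closed.
        apply: (@closed_comp _ _ sin [set x | e <= x]).
          by move=> t _; exact: continuous_sin.
        exact: closed_ge.
      - exact: segment_compact.
      - by move=> t [].
    move=> t [/=]; rewrite !in_itv /= => /andP[t0 tpi] te.
    have st : 0 < sin t by exact: lt_le_trans te.
    rewrite !lt_neqAle t0 tpi !andbT; apply/andP; split.
      by apply: contraTneq st => <-; rewrite sin0 ltxx.
    by apply: contraTneq st => ->; rewrite sinpi ltxx.
  move=> t nt; rewrite /ext0pi; case: ifPn => // t0; apply: f0 => //.
  rewrite leNgt; apply/negP => et; apply: nt; split => /=.
    by rewrite in_itv /= !ltW//; case/andP: t0.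
  exact: ltW.
Qed.

Lemma C1c_derive_continuous phi : C1c_0pi phi -> continuous (derive1 phi).
Proof. by case. Qed.

Lemma Rintegral_C1c_derive phi : C1c_0pi phi ->
  \int[leb]_(t in I0pi) derive1 phi t = 0.
Proof.
move=> cphi; have cd := C1c_derive_continuous cphi.
rewrite (Rintegral_0pi_derive (fun x => C1c_is_derive x cphi) cd).
by rewrite !(C1c_out cphi) ?subrr// ltxx ?andbF.
Qed.

Lemma continuous_L2 phi : continuous phi -> L2_0pi phi.
Proof.
move=> cphi; split.
  apply: measurable_funS (measurableT) _ _ => //.
  exact: continuous_measurable_fun.
apply: (@continuous_integrable_0pi (fun x => phi x ^+ 2)) => x.
exact: (continuous_comp (cphi x) (@exprn_continuous _ 2 _)).
Qed.

Lemma C1c_weak_derivative u : C1c_0pi u -> weak_derivative_0pi u (derive1 u).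
Proof.
move=> cu; have ccu := C1c_continuous cu.
have ccdu := C1c_derive_continuous cu.
split.
- apply: open_integrable_locally; first exact: itv_open.
  exact: continuous_integrable_0pi.
- apply: open_integrable_locally; first exact: itv_open.
  exact: continuous_integrable_0pi.
move=> phi cphi; have ccphi := C1c_continuous cphi.
have ccdphi := C1c_derive_continuous cphi.
have c1 : continuous (fun t => derive1 u t * phi t).
  by move=> t; apply: continuous_at_mulf; [exact: ccdu|exact: ccphi].
have c2 : continuous (fun t => u t * derive1 phi t).
  by move=> t; apply: continuous_at_mulf; [exact: ccu|exact: ccdphi].
have : \int[leb]_(t in I0pi) (derive1 u t * phi t + u t * derive1 phi t) = 0.
  have d x : is_derive x 1 (fun t => u t * phi t)
      (derive1 u x * phi x + u x * derive1 phi x).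
    by apply: is_derive_mulf; exact: C1c_is_derive.
  rewrite (Rintegral_0pi_derive d).
    by rewrite !(C1c_out cu) ?mul0r ?subrr// ltxx ?andbF.
  by move=> t; apply: continuous_at_addf; [exact: c1|exact: c2].
rewrite RintegralD//; [|exact: continuous_integrable_0pi..].
by move/eqP; rewrite addrC addr_eq0 => /eqP.
Qed.

Lemma C1c_H10 u : C1c_0pi u -> H10_0pi u.
Proof.
move=> cu; split; first exact/continuous_L2/C1c_continuous.
exists (derive1 u); split.
- exact/continuous_L2/C1c_derive_continuous.
- exact: C1c_weak_derivative.
exists (fun=> u); split => //.
- under eq_fun do under eq_Rintegral do rewrite subrr expr0n /=.
  by rewrite Rintegral_cst// mul0r; exact: cvg_cst.
- under eq_fun do under eq_Rintegral do rewrite subrr expr0n /=.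
  by rewrite Rintegral_cst// mul0r; exact: cvg_cst.
Qed.

End TestFunctions.

(** * Hardy's inequality *)

Section Hardy.
Variable R : realType.
Implicit Types (f g u v phi psi : R -> R) (x t s e : R).
Notation I0pi := (`]0, (pi : R)[%classic).
Notation leb := (@lebesgue_measure R).

Definition integrable_0pi f := leb.-integrable I0pi (EFin \o f).

Lemma in_0piP t : I0pi t <-> 0 < t < pi.
Proof. by rewrite /= in_itv. Qed.

Lemma integrable_0pi_measurable f : integrable_0pi f -> measurable_fun I0pi f.
Proof. by move=> /measurable_int /measurable_EFinP. Qed.

Lemma integrable_0pi_le f g : measurable_fun I0pi f -> integrable_0pi g ->
  (forall t, 0 < t < pi -> `|f t| <= g t) -> integrable_0pi f.
Proof.
move=> mf ig fg; apply: le_integrable ig => //; first exact/measurable_EFinP.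
move=> t /in_0piP t0 /=; rewrite lee_fin (le_trans (fg _ t0))//.
exact: ler_norm.
Qed.

Lemma integrable_0piD f g : integrable_0pi f -> integrable_0pi g ->
  integrable_0pi (fun t => f t + g t).
Proof. by move=> fi gi; apply: (integrableD _ fi gi). Qed.

Lemma integrable_0piB f g : integrable_0pi f -> integrable_0pi g ->
  integrable_0pi (fun t => f t - g t).
Proof. by move=> fi gi; apply: (integrableB _ fi gi). Qed.

Lemma integrable_0piZ (k : R) f : integrable_0pi f ->
  integrable_0pi (fun t => k * f t).
Proof. by move=> fi; apply: (integrableZl _ k fi). Qed.

Lemma eq_integrable_0pi f g : (forall t, 0 < t < pi -> f t = g t) ->
  integrable_0pi f -> integrable_0pi g.
Proof.
move=> fg; apply: eq_integrable => // t; rewrite inE => /in_0piP t0.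
by rewrite /= fg.
Qed.

Lemma eq_Rintegral_0pi f g : (forall t, 0 < t < pi -> f t = g t) ->
  \int[leb]_(t in I0pi) f t = \int[leb]_(t in I0pi) g t.
Proof.
by move=> fg; apply: eq_Rintegral => t; rewrite inE => /in_0piP; exact: fg.
Qed.

Lemma le_Rintegral_0pi f g : integrable_0pi f -> integrable_0pi g ->
  (forall t, 0 < t < pi -> f t <= g t) ->
  \int[leb]_(t in I0pi) f t <= \int[leb]_(t in I0pi) g t.
Proof.
by move=> fi gi fg; apply: le_Rintegral => // t /in_0piP; exact: fg.
Qed.

Lemma EFin_Rintegral_0pi f : integrable_0pi f ->
  (\int[leb]_(t in I0pi) f t)%:E = (\int[leb]_(t in I0pi) (f t)%:E)%E.
Proof. by move=> fi; rewrite /Rintegral fineK//; exact: integrable_fin_num. Qed.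

Lemma measurable_0pi_continuous f :
  (forall t, 0 < t < pi -> continuous_at t f) -> measurable_fun I0pi f.
Proof.
move=> cf; apply: open_continuous_measurable_fun; first exact: itv_open.
by move=> t; rewrite inE => /in_0piP; exact: cf.
Qed.

Lemma Rintegral_0pi_dominated (f_ : nat -> R -> R) f g :
  (forall m, measurable_fun I0pi (f_ m)) -> measurable_fun I0pi f ->
  integrable_0pi g ->
  (forall m t, 0 < t < pi -> `|f_ m t| <= g t) ->
  (forall t, 0 < t < pi -> f_ m t @[m --> \oo] --> f t) ->
  integrable_0pi f /\
  \int[leb]_(t in I0pi) f_ m t @[m --> \oo] --> \int[leb]_(t in I0pi) f t.
Proof.
move=> mf_ mf ig fg ff.
have [] := @dominated_convergence _ _ _ leb I0pi _ (fun m => EFin \o f_ m)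
  (EFin \o f) (EFin \o g).
- by [].
- by move=> m; move/measurable_EFinP: (mf_ m); apply.
- by move/measurable_EFinP: mf.
- apply: aeW => t /in_0piP t0; apply: cvg_EFin; first exact: nearW.
  exact: ff.
- exact: ig.
- by apply: aeW => t m /in_0piP t0; rewrite /= lee_fin fg.
move=> fi _ cv; split => //.
have fi_ m : integrable_0pi (f_ m) by exact: integrable_0pi_le (fg m).
apply: fine_cvg; rewrite -EFin_Rintegral_0pi//= in cv *.
Qed.

(** Monotone convergence, used for the finiteness of the limit integral: a uniform bound on
    truncations makes the untruncated function integrable. *)
Lemma integrable_0pi_monotone (f_ : nat -> R -> R) f (C : R) :
  (forall m, integrable_0pi (f_ m)) -> measurable_fun I0pi f ->
  (forall m t, 0 < t < pi -> 0 <= f_ m t) ->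
  (forall m m' t, (m <= m')%N -> 0 < t < pi -> f_ m t <= f_ m' t) ->
  (forall t, 0 < t < pi -> f_ m t @[m --> \oo] --> f t) ->
  (forall m, \int[leb]_(t in I0pi) f_ m t <= C) ->
  integrable_0pi f.
Proof.
move=> fi mf f0 nd ff fC; apply/integrableP; split; first exact/measurable_EFinP.
have cv t : 0 < t < pi -> (EFin \o f_^~ t) @ \oo --> (f t)%:E.
  by move=> t0; apply: cvg_EFin; [exact: nearW|exact: ff].
have -> : (\int[leb]_(t in I0pi) `|(EFin \o f) t| =
  \int[leb]_(t in I0pi) limn ((fun m => EFin \o f_ m)^~ t))%E.
  apply: eq_integral => t; rewrite inE => /in_0piP t0.
  rewrite (cvg_lim _ (cv t t0))//= ger0_norm//.
  apply: (ler_cvg_to (cvg_cst 0) (ff t t0)); apply: nearW => m; exact: f0.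
apply: (@le_lt_trans _ _ C%:E); last exact: ltry.
have mf_ m : measurable_fun I0pi (EFin \o f_ m).
  by move/measurable_EFinP: (integrable_0pi_measurable (fi m)).
have f0_ m t : I0pi t -> (0 <= (EFin \o f_ m) t)%E.
  by move=> /in_0piP t0; rewrite /= lee_fin f0.
have nd_ t : I0pi t ->
    {homo (fun m => (EFin \o f_ m) t) : m m' / (m <= m')%N >-> (m <= m')%E}.
  by move=> /in_0piP t0 m m' mm'; rewrite /= lee_fin nd.
rewrite monotone_convergence//; apply: lime_le.
  apply: ereal_nondecreasing_is_cvgn => m m' mm'.
  apply: ge0_le_integral => //; [exact: f0_|exact: mf_|exact: mf_|].
  by move=> t t0; exact: nd_.
by apply: nearW => m /=; rewrite -EFin_Rintegral_0pi// lee_fin.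
Qed.

(* Square completion with [phi cot / 2]: the cross term is half the derivative
   of [phi^2 cot], up to [phi^2 / sin^2]. *)
Lemma hardy_C1c phi : C1c_0pi phi ->
  let q := ext0pi (fun t => phi t ^+ 2 / sin t ^+ 2) in
  continuous q /\
  \int[leb]_(t in I0pi) q t <= 4 * \int[leb]_(t in I0pi) derive1 phi t ^+ 2.
Proof.
move=> cphi q; have [e e0 phi0] := C1c_support cphi.
have dphi x : is_derive x 1 phi (derive1 phi x) by exact: C1c_is_derive.
have ccphi := C1c_continuous cphi.
have cdphi := C1c_derive_continuous cphi.
have sin0 s : 0 < s < pi -> sin s != 0.
  by move=> s0; rewrite gt_eqF// sin_gt0_pi.
have [cq _] : C1c_0pi q /\ forall t, derive1 q t = ext0pi (fun t =>
    2 * phi t * derive1 phi t / sin t ^+ 2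
    - 2 * phi t ^+ 2 * cos t / sin t ^+ 3) t.
  apply: (C1c_ext e0) => s s0.
  - derivef; first by rewrite expf_eq0 sin0.
    by rewrite /=; field; rewrite sin0.
  - have := ccphi s; have := cdphi s => ? ?.
    by contf; rewrite expf_eq0 sin0.
  - by move=> /phi0 ->; rewrite expr0n mul0r.
have cqc := C1c_continuous cq; split=> //.
pose dF t := 2 * phi t * derive1 phi t * cos t / sin t - phi t ^+ 2 / sin t ^+ 2.
have [cF dFE] : C1c_0pi (ext0pi (fun t => phi t ^+ 2 * cos t / sin t)) /\
   forall t, derive1 (ext0pi (fun t => phi t ^+ 2 * cos t / sin t)) t = ext0pi dF t.
  apply: (C1c_ext e0) => s s0.
  - derivef; first by rewrite sin0.
    rewrite /dF /=.
    have -> : phi s ^+ 2 / sin s ^+ 2 =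
      phi s ^+ 2 * (cos s ^+ 2 + sin s ^+ 2) / sin s ^+ 2.
      by rewrite cos2Dsin2 mulr1.
    by field; rewrite sin0.
  - have := ccphi s; have := cdphi s => ? ?.
    by rewrite /dF; contf; rewrite ?expf_eq0 sin0.
  - by move=> /phi0 ->; rewrite expr0n !mul0r.
have IF := Rintegral_C1c_derive cF.
have i1 : integrable_0pi (fun t => derive1 phi t ^+ 2).
  by apply: continuous_integrable_0pi => t; have := cdphi t => ?; contf.
have i2 : integrable_0pi (derive1 (ext0pi (fun t => phi t ^+ 2 * cos t / sin t))).
  exact/continuous_integrable_0pi/C1c_derive_continuous.
set F' := derive1 (ext0pi _) in dFE IF i2.
(* F' has zero integral, so subtracting 2 F' reduces the claim to a pointwise inequality between
   integrands. *)
have -> : 4 * \int[leb]_(t in I0pi) derive1 phi t ^+ 2 =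
    \int[leb]_(t in I0pi) (4 * derive1 phi t ^+ 2 - 2 * F' t).
  rewrite RintegralB//; [|exact: integrable_0piZ..].
  by rewrite !RintegralZl// IF mulr0 subr0.
apply: le_Rintegral_0pi.
- exact: continuous_integrable_0pi.
- by apply: integrable_0piB; exact: integrable_0piZ.
move=> t t0; rewrite dFE /q /ext0pi t0 /dF.
have -> : phi t ^+ 2 / sin t ^+ 2 =
      phi t ^+ 2 * (cos t ^+ 2 + sin t ^+ 2) / sin t ^+ 2.
  by rewrite cos2Dsin2 mulr1.
rewrite -subr_ge0; set X := (X in 0 <= X).
have -> : X = (2 * derive1 phi t - phi t * cos t / sin t) ^+ 2 + phi t ^+ 2.
  by rewrite /X; field; rewrite sin0.
by rewrite addr_ge0// sqr_ge0.
Qed.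

Lemma L2_subr_sqr u v : L2_0pi u -> L2_0pi v ->
  integrable_0pi (fun t => (u t - v t) ^+ 2).
Proof.
move=> [mu iu] [mv iv].
apply: (@integrable_0pi_le _ (fun t => 2 * u t ^+ 2 + 2 * v t ^+ 2)).
- by apply: measurable_funX; exact: measurable_funB.
- by apply: integrable_0piD; exact: integrable_0piZ.
- move=> t _; rewrite ger0_norm ?sqr_ge0// -subr_ge0.
  rewrite (_ : _ - _ = (u t + v t) ^+ 2) ?sqr_ge0//; ring.
Qed.

Lemma Rintegral_sqr_le u v : L2_0pi u -> L2_0pi v ->
  \int[leb]_(t in I0pi) u t ^+ 2 <=
  2 * \int[leb]_(t in I0pi) (u t - v t) ^+ 2 + 2 * \int[leb]_(t in I0pi) v t ^+ 2.
Proof.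
move=> Lu Lv; have iuv := L2_subr_sqr Lu Lv.
have [_ iu] := Lu; have [_ iv] := Lv.
rewrite -!RintegralZl// -RintegralD//; [|exact: integrable_0piZ..].
apply: le_Rintegral_0pi => //.
  by apply: integrable_0piD; exact: integrable_0piZ.
move=> t _; rewrite -subr_ge0.
rewrite (_ : _ - _ = (u t - 2 * v t) ^+ 2) ?sqr_ge0//; ring.
Qed.

Lemma cvgn_invS : (m.+1%:R^-1 : R) @[m --> \oo] --> (0 : R).
Proof. exact: cvg_harmonic. Qed.

(** The approximants converge only in L^2, so Hardy's inequality does not pass to the limit with the
    unbounded weight 1 / sin^2. With the bounded weights [om m] it does, with a bound independent of
    m, and m then tends to infinity. *)
Lemma H10_div_sin u : H10_0pi u -> integrable_0pi (fun t => u t / sin t).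
Proof.
move=> [Lu [v [Lv _ [phi [cphi phiu phiv]]]]].
have sin0 t : 0 < t < pi -> 0 < sin t by exact: sin_gt0_pi.
pose om (m : nat) (t : R) := (Num.max (sin t) m.+1%:R^-1)^-1.
have max0 m t : 0 < Num.max (sin t) m.+1%:R^-1 :> R.
  by rewrite lt_max invr_gt0 ltr0n orbT.
have om0 m t : 0 < om m t by rewrite invr_gt0.
have om_le m t : om m t <= m.+1%:R.
  by rewrite /om invf_ple ?posrE ?ltr0n// le_max lexx orbT.
have om_le_sin m t : 0 < t < pi -> om m t <= (sin t)^-1.
  by move=> /sin0 st; rewrite /om lef_pV2 ?posrE// le_max lexx.
have om_nd m m' t : (m <= m')%N -> om m t <= om m' t.
  move=> mm'; rewrite /om lef_pV2 ?posrE// ge_max !le_max lexx /=.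
  by rewrite lef_pV2 ?posrE ?ltr0n// ler_nat ltnS mm' orbT.
have om_cvg t : 0 < t < pi -> om m t @[m --> \oo] --> (sin t)^-1.
  move=> /sin0 st; apply: cvg_near_cst; near=> m.
  rewrite /om max_l//; apply: ltW; near: m.
  exact: (cvgr_lt _ cvgn_invS).
have mom m : measurable_fun I0pi (om m).
  apply: measurable_0pi_continuous => t _; apply: continuous_at_invf.
    by rewrite gt_eqF.
  apply: (@continuous_max _ _ sin (cst _)); first exact: continuous_sin.
  exact: cst_continuous.
have [mu iu] := Lu.
have Lphi m : L2_0pi (phi m) by exact/continuous_L2/C1c_continuous.
have Ldphi m : L2_0pi (derive1 (phi m)).
  exact/continuous_L2/C1c_derive_continuous.
pose B := \int[leb]_(t in I0pi) v t ^+ 2.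
have iuom m : integrable_0pi (fun t => u t ^+ 2 * om m t ^+ 2).
  apply: (@integrable_0pi_le _ (fun t => m.+1%:R ^+ 2 * u t ^+ 2)).
  - by apply: measurable_funM; exact: measurable_funX.
  - exact: integrable_0piZ.
  - move=> t _; rewrite ger0_norm; last by rewrite mulr_ge0 ?sqr_ge0.
    by rewrite mulrC ler_wpM2r ?sqr_ge0// ler_sqr ?nnegrE ?ler0n// ltW.
have bound m : \int[leb]_(t in I0pi) (u t ^+ 2 * om m t ^+ 2) <= 16 * B + 1.
  (* Chosen so that the two approximation errors, with coefficients 2 (m+1)^2 and 16, add up to at
     most 1; the index k of the approximant depends on m. *)
  pose d := (2 * m.+1%:R ^+ 2 + 16 : R).
  have d0 : 0 < d by rewrite ltr_wpDl// mulr_ge0 ?sqr_ge0.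
  have [k [k1 k2]] : exists k,
     \int[leb]_(t in I0pi) ((phi k t - u t) ^+ 2) < (d * 1)^-1 /\
     \int[leb]_(t in I0pi) ((derive1 (phi k) t - v t) ^+ 2) < (d * 1)^-1.
    apply: (@filter_ex _ \oo); apply: filterI.
      by apply: (cvgr_lt _ phiu); rewrite invr_gt0 mulr1.
    by apply: (cvgr_lt _ phiv); rewrite invr_gt0 mulr1.
  have [cq hq] := hardy_C1c (cphi k).
  have iq := continuous_integrable_0pi cq.
  have iphiu := L2_subr_sqr (Lphi k) Lu.
  apply: (@le_trans _ _ (2 * m.+1%:R ^+ 2 *
     \int[leb]_(t in I0pi) (phi k t - u t) ^+ 2 +
     2 * (4 * (2 * \int[leb]_(t in I0pi) (derive1 (phi k) t - v t) ^+ 2 + 2 * B)))).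
    apply: (@le_trans _ _ (2 * m.+1%:R ^+ 2 *
     \int[leb]_(t in I0pi) (phi k t - u t) ^+ 2 + 2 * 
     \int[leb]_(t in I0pi) ext0pi (fun t => phi k t ^+ 2 / sin t ^+ 2) t)).
      rewrite -!RintegralZl// -RintegralD//; [|exact: integrable_0piZ..].
      apply: le_Rintegral_0pi => //.
        by apply: integrable_0piD; exact: integrable_0piZ.
      move=> t t0; rewrite /ext0pi t0.
      have h1 : u t ^+ 2 <= 2 * (phi k t - u t) ^+ 2 + 2 * phi k t ^+ 2.
        rewrite -subr_ge0 (_ : _ - _ = (u t - 2 * phi k t) ^+ 2) ?sqr_ge0//.
        by ring.
      apply: (le_trans (ler_wpM2r (sqr_ge0 _) h1)); rewrite mulrDl; apply: lerD.
        rewrite mulrAC ler_wpM2r ?sqr_ge0// ler_wpM2l//.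
        by rewrite ler_sqr ?nnegrE ?ler0n// ltW.
      rewrite -mulrA ler_wpM2l// ler_wpM2l ?sqr_ge0// -exprVn.
      by rewrite ler_sqr ?nnegrE ?om_le_sin// ltW// invr_gt0 sin0.
    rewrite lerD2l ler_wpM2l// (le_trans hq)// ler_wpM2l//.
    exact: Rintegral_sqr_le.
  have -> : 2 * (4 * (2 * \int[leb]_(t in I0pi) (derive1 (phi k) t - v t) ^+ 2 + 2 * B))
    = 16 * B + 16 * \int[leb]_(t in I0pi) (derive1 (phi k) t - v t) ^+ 2 by ring.
  rewrite addrCA lerD2l.
  apply: (@le_trans _ _ (2 * m.+1%:R ^+ 2 * d^-1 + 16 * d^-1)); last first.
    by rewrite -mulrDl divff// gt_eqF.
  rewrite mulr1 in k1 k2.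
  apply: lerD; apply: ler_wpM2l; rewrite ?mulr_ge0 ?sqr_ge0//; exact: ltW.
have mui : measurable_fun I0pi (fun t => (sin t)^-1).
  by apply: measurable_0pi_continuous => t /sin0 st; contf; rewrite gt_eqF.
have i2 : integrable_0pi (fun t => u t ^+ 2 * (sin t)^-1 ^+ 2).
  apply: (integrable_0pi_monotone iuom) bound.
  - by apply: measurable_funM; exact: measurable_funX.
  - by move=> m t _; rewrite mulr_ge0 ?sqr_ge0.
  - move=> m m' t mm' _; rewrite ler_wpM2l ?sqr_ge0// ler_sqr ?nnegrE ?om_nd//.
    exact: ltW.
    exact: ltW.
  - move=> t t0; apply: cvgM; first exact: cvg_cst.
    exact: (cvgM (om_cvg t t0) (om_cvg t t0)).
(* Since |x| <= 1 + x^2, square integrability on an interval of finite length gives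
   integrability. *)
apply: (@integrable_0pi_le _ (fun t => 1 + u t ^+ 2 * (sin t)^-1 ^+ 2)).
- exact: measurable_funM.
- apply: integrable_0piD => //.
  by apply: (@continuous_integrable_0pi _ (fun=> 1)); exact: cst_continuous.
- move=> t _; rewrite -exprMn; set x := u t / sin t.
  rewrite -(real_normK (num_real x)); have := normr_ge0 x; move: `|x| => y y0.
  by rewrite -subr_ge0 (_ : _ - _ = (y - 2^-1) ^+ 2 + 3/4) ?addr_ge0 ?sqr_ge0//; field.
Unshelve. all: by end_near. Qed.

End Hardy.

(** * Weak form of the equation for g *)

Section WeakFormulation.
Variable R : realType.
Implicit Types (f g u v phi psi : R -> R) (x t s e : R).
Notation I0pi := (`]0, (pi : R)[%classic).
Notation leb := (@lebesgue_measure R).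

Lemma is_derive_pospart n x :
  is_derive x 1 (fun y : R => Num.max y 0 ^+ n.+2) (n.+2%:R * Num.max x 0 ^+ n.+1).
Proof.
have cmax : continuous (fun y : R => Num.max y 0).
  move=> y; apply: (@continuous_max _ _ id (cst 0)); first exact: cvg_id.
  exact: cst_continuous.
have [x0|x0|->] := ltgtP x 0.
- rewrite expr0n mulr0; apply: (@near_eq_is_derive _ _ _ (cst 0)).
  near=> y; rewrite max_r ?expr0n//=; apply: ltW; near: y; exact: lt_nbhsl.
- apply: (@near_eq_is_derive _ _ _ (fun y : R => y ^+ n.+2)).
    near=> y; rewrite max_l//; apply: ltW; near: y; exact: lt_nbhsr.
  by derivef; rewrite /= mulr1.
- rewrite expr0n mulr0; apply/is_derive1_caratheodory.
  (* At 0 the difference quotient is again a power of the positive part, which is continuous and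
     vanishes there. *)
  exists (fun y => Num.max y 0 ^+ n.+1); split.
  + move=> y; rewrite maxxx expr0n /= !subr0; case: (leP y 0) => y0.
      by rewrite !expr0n mul0r.
    by rewrite exprSr.
  + exact: continuous_at_exprf (cmax _).
  + by rewrite maxxx expr0n.
Unshelve. all: by end_near. Qed.

(* The cube makes the cutoff [C^2]. *)
Definition cutoff e t : R := Num.max (1 - e / sin t) 0 ^+ 3.
Definition cutoff1 e t : R :=
  3 * Num.max (1 - e / sin t) 0 ^+ 2 * (e * cos t / sin t ^+ 2).
Definition cutoff2 e t : R :=
  6 * Num.max (1 - e / sin t) 0 * (e * cos t / sin t ^+ 2) ^+ 2 -
  3 * Num.max (1 - e / sin t) 0 ^+ 2 *
    (e / sin t + 2 * e * cos t ^+ 2 / sin t ^+ 3).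

Section Cutoff.
Variables (e t : R).
Hypotheses (e0 : 0 < e) (t0 : 0 < t < pi).

Let s0 : 0 < sin t. Proof. exact: sin_gt0_pi. Qed.
Let sN : sin t != 0. Proof. by rewrite gt_eqF. Qed.

Let dy : is_derive t 1 (fun t => 1 - e / sin t) (e * cos t / sin t ^+ 2).
Proof. by derivef => //=; field. Qed.

Lemma is_derive_cutoff : is_derive t 1 (cutoff e) (cutoff1 e t).
Proof. exact: (is_derive_compf (is_derive_pospart 1 _) dy). Qed.

Lemma is_derive_cutoff1 : is_derive t 1 (cutoff1 e) (cutoff2 e t).
Proof.
pose p2 y := Num.max (1 - e / sin y) 0 ^+ 2.
have d2 : is_derive t 1 p2 _ := is_derive_compf (is_derive_pospart 0 _) dy.
change (is_derive t 1 (fun y => 3 * p2 y * (e * cos y / sin y ^+ 2))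
  (cutoff2 e t)).
derivef; first by rewrite expf_eq0.
by rewrite /cutoff2 /p2 expr1; field.
Qed.

Lemma cutoff_small : sin t <= e ->
  [/\ cutoff e t = 0, cutoff1 e t = 0 & cutoff2 e t = 0].
Proof.
move=> te; have y0 : Num.max (1 - e / sin t) 0 = 0.
  by rewrite max_r// subr_le0 ler_pdivlMr// mul1r.
by rewrite /cutoff /cutoff1 /cutoff2 y0 !expr0n !(mulr0, mul0r) subrr.
Qed.

Lemma cutoff_le1 : 0 <= Num.max (1 - e / sin t) 0 <= 1.
Proof.
by rewrite le_max lexx orbT /= ge_max ler01 andbT gerBl divr_ge0// ltW.
Qed.

(** The bounds are uniform in [e]: the cutoff is nonzero only where e < sin t, so r = e / sin t
    stays in [0, 1] and each derivative costs one factor 1 / sin t. *)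
Lemma cutoff_bounds :
  [/\ `|cutoff e t| <= 1, `|cutoff1 e t| <= 3 / sin t &
      `|cutoff2 e t| <= 15 / sin t ^+ 2].
Proof.
have [te|te] := leP (sin t) e.
  have [-> -> ->] := cutoff_small te.
  by rewrite normr0 !divr_ge0// ?sqr_ge0// ltW.
rewrite /cutoff /cutoff1 /cutoff2; have := cutoff_le1.
set y := Num.max _ _ => /andP[y0 y1].
have c1 : `|cos t| <= 1 by exact: cos_max.
have es : 0 <= e / sin t <= 1.
  apply/andP; split; first by apply: divr_ge0; exact: ltW.
  by rewrite ler_pdivrMr// mul1r ltW.
move: es; set r := e / sin t => /andP[r0 r1].
have -> : e * cos t / sin t ^+ 2 = r * cos t / sin t by rewrite /r; field.
have -> : r + 2 * e * cos t ^+ 2 / sin t ^+ 3 =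
    (r * (sin t ^+ 2 + 2 * cos t ^+ 2)) / sin t ^+ 2 by rewrite /r; field.
have -> : sin t ^+ 2 + 2 * cos t ^+ 2 = 1 + cos t ^+ 2.
  by rewrite sin2cos2; ring.
have y2 : 0 <= y ^+ 2 <= 1 by rewrite sqr_ge0 /= exprn_ile1.
have cc : 0 <= cos t ^+ 2 <= 1.
  by rewrite sqr_ge0 cos2sin2 gerBl sqr_ge0.
have mul01 (a b : R) : 0 <= a <= 1 -> 0 <= b <= 1 -> 0 <= a * b <= 1.
  by move=> /andP[a0 a1] /andP[b0 b1]; rewrite mulr_ge0 // mulr_ile1.
have r01 : 0 <= r <= 1 by rewrite r0.
have si : 0 < (sin t)^-1 by rewrite invr_gt0.
have y01 : 0 <= y <= 1 by rewrite y0.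
split.
- by rewrite ger0_norm ?exprn_ge0// exprn_ile1.
- have /andP[b0 b1] := mul01 _ _ y2 r01.
  rewrite (_ : _ * _ = 3 * (y ^+ 2 * r) * cos t / sin t); last by field.
  rewrite normrM (gtr0_norm si) (ler_pM2r si) -mulrA normrM normrM.
  rewrite (ger0_norm b0) ger0_norm//.
  have /andP[_ d1] : 0 <= y ^+ 2 * r * `|cos t| <= 1.
    by apply: mul01; rewrite ?b0 ?b1 ?normr_ge0.
  by rewrite ler_piMr.
- have /andP[a0 a1] := mul01 _ _ (mul01 _ _ y01 (mul01 _ _ r01 r01)) cc.
  have /andP[b0 b1] := mul01 _ _ y2 r01.
  have /andP[d0 d1] := mul01 _ _ (mul01 _ _ y2 r01) cc.
  set a := y * _ * _ in a0 a1; set b := y ^+ 2 * r in b0 b1.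
  set d := _ * cos t ^+ 2 in d0 d1.
  rewrite (_ : _ - _ = (6 * a - 3 * b - 3 * d) / sin t ^+ 2); last first.
    by rewrite /a /b /d; field.
  have s2 : 0 < (sin t ^+ 2)^-1 by rewrite invr_gt0 exprn_gt0.
  rewrite normrM (gtr0_norm s2) (ler_pM2r s2).
  by rewrite ler_norml; apply/andP; split; lra.
Qed.

End Cutoff.

Lemma cutoff_cvg t : 0 < t < pi ->
  [/\ cutoff m.+1%:R^-1 t @[m --> \oo] --> (1 : R),
      cutoff1 m.+1%:R^-1 t @[m --> \oo] --> (0 : R) &
      cutoff2 m.+1%:R^-1 t @[m --> \oo] --> (0 : R)].
Proof.
move=> t0; have st : 0 < sin t by exact: sin_gt0_pi.
have ce := @cvgn_invS R.
have cst (c : R) : c @[m --> \oo] --> c by exact: cvg_cst.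
have cy : Num.max (1 - m.+1%:R^-1 / sin t) 0 @[m --> \oo] --> (1 : R).
  rewrite -[X in _ --> X]subr0 -[X in _ - X](mul0r (sin t)^-1).
  have : (1 - m.+1%:R^-1 / sin t) @[m --> \oo] --> 1 - 0 / sin t.
    exact: (cvgB (cst 1) (cvgM ce (cst (sin t)^-1))).
  apply: cvg_trans; apply: near_eq_cvg; near=> m.
  rewrite max_l// subr_ge0 ler_pdivrMr// mul1r; apply: ltW; near: m.
  exact: (cvgr_lt _ ce).
have cX n : Num.max (1 - m.+1%:R^-1 / sin t) 0 ^+ n @[m --> \oo] --> (1 : R).
  rewrite -[X in _ --> X](expr1n _ n).
  elim: n => [|n IH]; first exact: (cst 1).
  by under eq_fun do rewrite exprS; rewrite exprS; exact: (cvgM cy IH).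
have cr (c : R) : m.+1%:R^-1 * c @[m --> \oo] --> (0 : R).
  by rewrite -[X in _ --> X](mul0r c); exact: (cvgM ce (cst c)).
have cd : m.+1%:R^-1 * cos t / sin t ^+ 2 @[m --> \oo] --> (0 : R).
  by under eq_fun do rewrite -mulrA; exact: cr.
split; first exact: cX.
- rewrite -[X in _ --> X](mulr0 (3 * 1)).
  exact: (cvgM (cvgM (cst 3) (cX 2)) cd).
- rewrite -[X in _ --> X](_ : 6 * 1 * (0 * 0) - 3 * 1 * (0 + 0) = 0); last by ring.
  apply: (cvgB (cvgM (cvgM (cst 6) cy) (cvgM cd cd)) (cvgM (cvgM (cst 3) (cX 2)) _)).
  apply: cvgD; first exact: cr.
  under eq_fun do rewrite (mulrC 2) -!mulrA; exact: cr.
Unshelve. all: by end_near. Qed.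

(** The exponent may be negative, as n / 2 - 2 is for n = 2 and n = 3; this is harmless because sin
    is bounded below on the support of [phi]. *)
Lemma C1c_powR_sin (a : R) phi : C1c_0pi phi ->
  C1c_0pi (fun t => sin t `^ a * phi t).
Proof.
move=> cphi; have [e e0 phi0] := C1c_support cphi.
rewrite (_ : (fun t => _) = ext0pi (fun t => sin t `^ a * phi t)); last first.
  apply/funext => t; rewrite /ext0pi; case: ifPn => // /negP t0.
  by rewrite (C1c_out cphi t0) mulr0.
have dp s b : 0 < s < pi -> is_derive s 1 (fun t => sin t `^ b)
    (b * sin s `^ (b - 1) * cos s).
  move=> /sin_gt0_pi s0.
  exact: (is_derive_compf (is_derive1_powR _ s0) (is_derive_sin s)).
have cp s b : 0 < s < pi -> continuous_at s (fun t => sin t `^ b).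
  by move=> s0; exact: is_derive_continuous (dp _ _ s0).
pose df t := a * sin t `^ (a - 1) * cos t * phi t + sin t `^ a * derive1 phi t.
suff [] : C1c_0pi (ext0pi (fun t => sin t `^ a * phi t)) /\
   forall t, derive1 (ext0pi (fun t => sin t `^ a * phi t)) t = ext0pi df t by [].
apply: (C1c_ext e0) => s s0.
- exact: (is_derive_mulf (dp _ _ s0) (C1c_is_derive s cphi)).
- have := cp s a s0; have := cp s (a - 1) s0 => c1 c2.
  have c3 : continuous_at s phi by exact: C1c_continuous.
  have c4 : continuous_at s (derive1 phi) by exact: C1c_derive_continuous.
  rewrite /df; apply: continuous_at_addf; apply: continuous_at_mulf => //.
  apply: continuous_at_mulf; last exact: continuous_cos.
  by apply: continuous_at_mulf => //; exact: cvg_cst.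
- by move=> /phi0 ->; rewrite mulr0.
Qed.

Lemma C1c_in_V n phi : C1c_0pi phi -> in_V n phi.
Proof.
move=> cphi; split; last exact/C1c_H10/C1c_powR_sin.
have /C1c_continuous cp := C1c_powR_sin (n%:R / 2 - 2) cphi.
under [X in L2_0pi X]eq_fun do rewrite -mulrA.
apply: continuous_L2 => t.
exact: (@continuous_at_mulf _ _ _ t (@cvg_cst _ _ _ _ _) (cp t)).
Qed.

Definition weight n (kap : R) t : R := sin t ^+ (n - 2) * expR (kap * cos t).
(** The logarithmic derivative of [weight], so that (w f')' = w (f'' + drift f'). *)
Definition drift n (kap : R) t : R :=
  (n%:R - 2) * cos t / sin t - kap * sin t.

(** Since n - 2 >= n / 2 - 1 and sin <= 1, the weight is at most exp |kap| times sin^(n/2-1), and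
    Hardy's inequality applies to sin^(n/2-1) g. *)
Lemma in_V_div_sin n kap g : (2 <= n)%N -> in_V n g ->
  measurable_fun I0pi g -> integrable_0pi (fun t => g t * weight n kap t / sin t).
Proof.
move=> n2 [_ Hg] mg; have iu := H10_div_sin Hg.
have mus : measurable_fun I0pi (fun t => (sin t)^-1).
  by apply: measurable_0pi_continuous => t /sin_gt0_pi st; contf; rewrite gt_eqF.
have mw : measurable_fun I0pi (weight n kap).
  by apply: measurable_0pi_continuous => t _; rewrite /weight; contf.
apply: (@integrable_0pi_le _ _ (fun t => expR `|kap| *
    `|sin t `^ (n%:R / 2 - 1) * g t / sin t|)).
- by apply: measurable_funM => //; exact: measurable_funM.
- exact/integrable_0piZ/integrable_norm.
move=> t /sin_gt0_pi st; have st1 := sin_le1 t.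
rewrite mulrAC (mulrC _ (weight _ _ _)) -(mulrA (_ `^ _)).
move: (g t / sin t) => x; rewrite !normrM mulrA ler_wpM2r//.
rewrite (ger0_norm (powR_ge0 _ _)) mulrC.
apply: ler_pM => //.
  rewrite ger0_norm ?expR_ge0// ler_expR (le_trans (ler_norm _))//.
  by rewrite normrM ler_piMr// cos_max.
rewrite ger0_norm; last by rewrite exprn_ge0// ltW.
rewrite -powR_mulrn; last exact: ltW.
apply: ger_powR; first by rewrite st st1.
rewrite natrB// -subr_ge0 (_ : _ - _ = (n%:R - 2) / 2); last by field.
by rewrite divr_ge0// subr_ge0 ler_nat.
Qed.

Section Test.
Variables (n : nat) (kap : R) (g : R -> R).
Hypotheses (n2 : (2 <= n)%N) (gci : solves_GCI n kap g).
Notation w := (weight n kap).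
Notation q := (drift n kap).

Lemma continuous_weight : continuous w.
Proof. by move=> t; rewrite /weight; contf. Qed.

Lemma is_derive_weight t : 0 < t < pi -> is_derive t 1 w (w t * q t).
Proof.
move=> /sin_gt0_pi st; rewrite /weight; derivef.
have -> : q t = (n - 2)%:R * cos t / sin t - kap * sin t.
  by rewrite /drift natrB.
(* The power rule produces the exponent (n - 2) - 1, which is truncated when n = 2. *)
by case: (n - 2)%N => [|N] /=; [field|rewrite exprS; field]; rewrite gt_eqF.
Qed.

Lemma solves_GCI_measurable : measurable_fun I0pi g.
Proof. by have [_ [dg [[]]]] := gci. Qed.

Lemma integrable_solves_GCI : integrable_0pi (fun t => g t * w t / sin t).
Proof.
by apply: in_V_div_sin => //; [case: gci|exact: solves_GCI_measurable].
Qed.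

(** The weak formulation tested against a [C^2] function [f] vanishing near the
    endpoints. As [w f'] is then an admissible test function for the weak
    derivative of [g], that derivative never has to be identified. *)
Lemma solves_GCI_test (f f1 f2 : R -> R) (e K : R) : 0 < e ->
  (forall t, 0 < t < pi -> is_derive t 1 f (f1 t)) ->
  (forall t, 0 < t < pi -> is_derive t 1 f1 (f2 t)) ->
  (forall t, 0 < t < pi -> continuous_at t f2) ->
  (forall t, 0 < t < pi -> sin t <= e -> f t = 0 /\ f1 t = 0) ->
  (forall t, 0 < t < pi -> `|f2 t + q t * f1 t| <= K / sin t) ->
  (forall t, 0 < t < pi -> `|(n%:R - 2) / sin t ^+ 2 * f t| <= K / sin t) ->
  \int[leb]_(t in I0pi) (g t * w t *
     ((n%:R - 2) / sin t ^+ 2 * f t - (f2 t + q t * f1 t))) =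
  \int[leb]_(t in I0pi) (w t * (sin t * f t)).
Proof.
move=> e0 df df1 cf2 f0 K1 K2.
have sin0 t : 0 < t < pi -> sin t != 0.
  by move=> /sin_gt0_pi st; rewrite gt_eqF.
have cq t : 0 < t < pi -> continuous_at t q.
  by move=> t0; rewrite /drift; contf; exact: sin0.
have cf1 t : 0 < t < pi -> continuous_at t f1.
  by move=> t0; exact: is_derive_continuous (df1 _ t0).
have cf t : 0 < t < pi -> continuous_at t f.
  by move=> t0; exact: is_derive_continuous (df _ t0).
have [cF dF] : C1c_0pi (ext0pi f) /\
    forall t, derive1 (ext0pi f) t = ext0pi f1 t.
  by apply: (C1c_ext e0) => // s s0 /(f0 _ s0)[].
pose ph1 t := w t * (f2 t + q t * f1 t).
have [cP dP] : C1c_0pi (ext0pi (fun t => w t * f1 t)) /\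
    forall t, derive1 (ext0pi (fun t => w t * f1 t)) t = ext0pi ph1 t.
  apply: (C1c_ext e0) => s s0.
  - apply: (is_derive_val (is_derive_mulf (is_derive_weight s0) (df1 _ s0))).
    by rewrite /ph1; ring.
  - have := cq _ s0; have := cf1 _ s0; have := cf2 _ s0 => ? ? ?.
    have ? : continuous_at s w by exact: continuous_weight.
    by rewrite /ph1; contf.
  - by move=> /(f0 _ s0)[_ ->]; rewrite mulr0.
have [Vg [dg wdg]] := gci.
move=> /(_ _ _ (C1c_in_V n cF) (C1c_weak_derivative cF)).
have [_ _ /(_ _ cP) gdg] := wdg.
have -> : \int[leb]_(t in I0pi) (sin t ^+ (n - 2) * expR (kap * cos t) *
    (dg t * derive1 (ext0pi f) t)) = - \int[leb]_(t in I0pi) (g t * ph1 t).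
  transitivity (\int[leb]_(t in I0pi) (dg t * ext0pi (fun t => w t * f1 t) t)).
    apply: eq_Rintegral_0pi => t t0; rewrite dF /ext0pi t0 /weight.
    by rewrite mulrCA.
  apply: oppr_inj; rewrite opprK -gdg; apply: eq_Rintegral_0pi => t t0.
  by rewrite dP /ext0pi t0.
have ig := integrable_solves_GCI; have mg := solves_GCI_measurable.
have mw : measurable_fun I0pi w.
  by apply: measurable_0pi_continuous => t _; exact: continuous_weight.
have gwK h : (forall t, 0 < t < pi -> continuous_at t h) ->
    (forall t, 0 < t < pi -> `|h t| <= K / sin t) ->
    integrable_0pi (fun t => g t * w t * h t).
  move=> ch hK.
  apply: (@integrable_0pi_le _ _ (fun t => K * `|g t * w t / sin t|)).
  - apply: measurable_funM; first exact: measurable_funM.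
    exact: measurable_0pi_continuous.
  - exact/integrable_0piZ/integrable_norm.
  move=> t t0; have st := sin_gt0_pi t0.
  move: (g t * w t) => x; rewrite normrM (normrM x) mulrCA ler_wpM2l//.
  by rewrite (le_trans (hK _ t0))// ger0_norm// invr_ge0 ltW.
move=> H; have {H}E : - (\int[leb]_(t in I0pi) (g t * ph1 t)) +
    \int[leb]_(t in I0pi) (g t * w t * ((n%:R - 2) / sin t ^+ 2 * f t)) =
    \int[leb]_(t in I0pi) (w t * (sin t * f t)).
  transitivity (\int[leb]_(t in I0pi) (sin t ^+ (n - 2) * expR (kap * cos t) *
     (sin t * ext0pi f t))); last first.
    by apply: eq_Rintegral_0pi => t t0; rewrite /ext0pi t0.
  rewrite -H; congr (_ + _); apply: eq_Rintegral_0pi => t t0.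
  by rewrite /ext0pi t0 -/(w t); ring.
rewrite -E [RHS]addrC -RintegralB//=.
- by apply: eq_Rintegral_0pi => t t0; rewrite /ph1; ring.
- apply: gwK => // t t0; have ? := cf _ t0.
  by contf; rewrite expf_eq0 sin0.
- apply: (@eq_integrable_0pi _ (fun t => g t * w t * (f2 t + q t * f1 t))).
    by move=> t _; rewrite /ph1 mulrA.
  apply: gwK => // t t0.
  have := cq _ t0; have := cf1 _ t0; have := cf2 _ t0 => ? ? ?.
  by contf.
Qed.

End Test.

End WeakFormulation.

(** * Removal of the cutoff *)

Section MomentIdentity.
Variable R : realType.
Implicit Types (f g u v phi psi : R -> R) (x t s e : R).
Notation I0pi := (`]0, (pi : R)[%classic).
Notation leb := (@lebesgue_measure R).

(** Test functions [A] times [cutoff e]: as [|A| <= C sin], every term where a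
    derivative falls on the cutoff is [O(1 / sin)] uniformly in [e], and
    [g w / sin] is integrable. *)
Lemma solves_GCI_moment n kap g (A A1 A2 : R -> R) (C : R) :
  (2 <= n)%N -> solves_GCI n kap g ->
  (forall t, is_derive t 1 A (A1 t)) -> (forall t, is_derive t 1 A1 (A2 t)) ->
  continuous A2 ->
  (forall t, 0 < t < pi -> `|A t| <= C * sin t) ->
  (forall t, 0 < t < pi -> `|A1 t| <= C) ->
  (forall t, 0 < t < pi -> `|A2 t| <= C) ->
  \int[leb]_(t in I0pi) (g t * weight n kap t *
     ((n%:R - 2) / sin t ^+ 2 * A t - (A2 t + drift n kap t * A1 t))) =
  \int[leb]_(t in I0pi) (weight n kap t * (sin t * A t)).
Proof.
move=> n2 gci dA dA1 cA2 CA CA1 CA2.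
have sin0 t : 0 < t < pi -> sin t != 0.
  by move=> /sin_gt0_pi st; rewrite gt_eqF.
have C0 : 0 <= C.
  have t0 : 0 < (pi / 2 : R) < pi.
    by rewrite divr_gt0 ?pi_gt0//= ltr_pdivrMr// ltr_pMr ?pi_gt0// ltr1n.
  exact: le_trans (CA1 _ t0).
have e0 m : 0 < m.+1%:R^-1 :> R by rewrite invr_gt0.
have n20 : 0 <= n%:R - 2 :> R by rewrite subr_ge0 ler_nat.
pose X m := cutoff m.+1%:R^-1 : R -> R.
pose X1 m := cutoff1 m.+1%:R^-1 : R -> R.
pose X2 m := cutoff2 m.+1%:R^-1 : R -> R.
have bX m t (t0 : 0 < t < pi) : [/\ `|X m t| <= 1, `|X1 m t| <= 3 / sin t &
    `|X2 m t| <= 15 / sin t ^+ 2] by exact: cutoff_bounds.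
have small m t (t0 : 0 < t < pi) : sin t <= m.+1%:R^-1 ->
    X m t = 0 /\ X1 m t = 0.
  by move=> /(cutoff_small t0)[].
have limX t (t0 : 0 < t < pi) : [/\ X m t @[m --> \oo] --> (1 : R),
    X1 m t @[m --> \oo] --> (0 : R) & X2 m t @[m --> \oo] --> (0 : R)].
  exact: cutoff_cvg.
have dX m t (t0 : 0 < t < pi) : is_derive t 1 (X m) (X1 m t).
  exact: is_derive_cutoff.
have dX1 m t (t0 : 0 < t < pi) : is_derive t 1 (X1 m) (X2 m t).
  exact: is_derive_cutoff1.
have cX2 m t (t0 : 0 < t < pi) : continuous_at t (X2 m).
  have c1 : continuous_at t (fun t => 1 - m.+1%:R^-1 / sin t).
    by contf; exact: sin0.
  have cp : continuous_at t (fun t => Num.max (1 - m.+1%:R^-1 / sin t) 0).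
    exact: (@continuous_max _ _ _ (cst 0) _ c1 (@cst_continuous _ _ 0 t)).
  pose p t := Num.max (1 - m.+1%:R^-1 / sin t) 0.
  change (continuous_at t (fun t => 6 * p t *
     (m.+1%:R^-1 * cos t / sin t ^+ 2) ^+ 2 - 3 * p t ^+ 2 *
    (m.+1%:R^-1 / sin t + 2 * m.+1%:R^-1 * cos t ^+ 2 / sin t ^+ 3))).
  have cp' : continuous_at t p := cp.
  by contf; rewrite ?expf_eq0 sin0.
clearbody X X1 X2.
pose f m t := A t * X m t.
pose f1 m t := A1 t * X m t + A t * X1 m t.
pose f2 m t := A2 t * X m t + 2 * A1 t * X1 m t + A t * X2 m t.
(* With the bounds 1, 3, 15 on the cutoff and its derivatives, the product rule gives 22 = 1 + 2 * 3
   + 15 for f'' and 4 = 1 + 3 for f'. The drift contributes 4 (n - 2 + |kap|) and the zero-order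
   term n - 2. *)
pose K := C * (22 + 5 * (n%:R - 2) + 4 * `|kap|).
have qb t : 0 < t < pi -> `|drift n kap t| <= (n%:R - 2 + `|kap|) / sin t.
  move=> t0; have st := sin_gt0_pi t0; have st1 := sin_le1 t.
  rewrite (_ : drift n kap t =
     ((n%:R - 2) * cos t - kap * sin t ^+ 2) / sin t); last first.
    by rewrite /drift; field; exact: sin0.
  rewrite normrM (@ger0_norm _ (sin t)^-1) ?invr_ge0 ?(ltW st)//.
  rewrite ler_wpM2r ?invr_ge0 ?(ltW st)// (le_trans (ler_normB _ _))// lerD//.
    by rewrite normrM ger0_norm// ler_piMr// cos_max.
  by rewrite normrM ler_piMr// normrX exprn_ile1// sin_max.
have fC m t : 0 < t < pi -> `|f m t| <= C * sin t.
  move=> t0; have [b0 _ _] := bX m t t0.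
  rewrite /f normrM (le_trans _ (CA _ t0))// ler_piMr//.
have f1C m t : 0 < t < pi -> `|f1 m t| <= 4 * C.
  move=> t0; have [b0 b1 _] := bX m t t0; have st := sin_gt0_pi t0.
  rewrite (_ : 4 * C = C * 1 + C * sin t * (3 / sin t)); last first.
    by field; exact: sin0.
  rewrite (le_trans (ler_normD _ _))// !normrM lerD// ler_pM//.
    exact: CA1.
  exact: CA.
have f2C m t : 0 < t < pi -> `|f2 m t| <= 22 * C / sin t.
  move=> t0; have [b0 b1 b2] := bX m t t0; have st := sin_gt0_pi t0.
  apply: (@le_trans _ _ (C * 1 + 2 * C * (3 / sin t) +
      C * sin t * (15 / sin t ^+ 2))).
    rewrite (le_trans (ler_normD _ _))// lerD//.
      rewrite (le_trans (ler_normD _ _))// !normrM lerD//.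
        by rewrite ler_pM// CA2.
      by rewrite ger0_norm// ler_pM// ler_pM2l// CA1.
    by rewrite normrM ler_pM// CA.
  rewrite -subr_ge0.
  rewrite (_ : _ - _ = C * (1 - sin t) / sin t); last by field; exact: sin0.
  by rewrite divr_ge0 ?(ltW st)// mulr_ge0// subr_ge0 sin_le1.
have f21K m t : 0 < t < pi -> `|f2 m t + drift n kap t * f1 m t| <= K / sin t.
  move=> t0; have st := sin_gt0_pi t0.
  apply: (@le_trans _ _ (22 * C / sin t +
      (n%:R - 2 + `|kap|) / sin t * (4 * C))).
    rewrite (le_trans (ler_normD _ _))// lerD ?f2C// normrM.
    by rewrite ler_pM// ?qb ?f1C.
  rewrite -subr_ge0 (_ : _ - _ = C * (n%:R - 2) / sin t); last first.
    by rewrite /K; field; exact: sin0.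
  by rewrite divr_ge0 ?(ltW st)// mulr_ge0.
have fK m t : 0 < t < pi -> `|(n%:R - 2) / sin t ^+ 2 * f m t| <= K / sin t.
  move=> t0; have st := sin_gt0_pi t0.
  have c0 : 0 <= (n%:R - 2) / sin t ^+ 2 by rewrite divr_ge0 ?sqr_ge0.
  rewrite normrM (ger0_norm c0).
  apply: (le_trans (ler_wpM2l c0 (fC m t t0))).
  rewrite -subr_ge0.
  rewrite (_ : _ - _ = C * (22 + 4 * (n%:R - 2) + 4 * `|kap|) / sin t).
    by rewrite divr_ge0 ?(ltW st)// mulr_ge0// !addr_ge0// mulr_ge0.
  by rewrite /K; field; exact: sin0.
have df m t (t0 : 0 < t < pi) : is_derive t 1 (f m) (f1 m t).
  exact: (is_derive_mulf (dA t) (dX m t t0)).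
have df1 m t (t0 : 0 < t < pi) : is_derive t 1 (f1 m) (f2 m t).
  have := is_derive_addf (is_derive_mulf (dA1 t) (dX m t t0))
    (is_derive_mulf (dA t) (dX1 m t t0)).
  by move=> /is_derive_val; apply; rewrite /f2; ring.
have cf2 m t (t0 : 0 < t < pi) : continuous_at t (f2 m).
  have ? := cX2 m t t0; have ? := cA2 t.
  have ? := is_derive_continuous (dX m t t0).
  have ? := is_derive_continuous (dX1 m t t0).
  have ? := is_derive_continuous (dA t); have ? := is_derive_continuous (dA1 t).
  by rewrite /f2; contf.
have f0 m t (t0 : 0 < t < pi) : sin t <= m.+1%:R^-1 -> f m t = 0 /\ f1 m t = 0.
  by move=> /(small m t t0)[x0 x1]; rewrite /f /f1 x0 x1 !mulr0 addr0.
have test m := solves_GCI_test n2 gci (e0 m) (df m) (df1 m) (cf2 m) (f0 m)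
  (f21K m) (fK m).
have cvgX t (t0 : 0 < t < pi) : f m t @[m --> \oo] --> A t /\
    (f2 m t + drift n kap t * f1 m t) @[m --> \oo] -->
      (A2 t + drift n kap t * A1 t).
  have [c0 c1 c2] := limX t t0.
  have cst (c : R) : c @[m --> \oo] --> c by exact: cvg_cst.
  split.
    by rewrite -[X in _ --> X]mulr1; exact: (cvgM (cst (A t)) c0).
  rewrite -[X in _ --> X](_ : (A2 t * 1 + 2 * A1 t * 0 + A t * 0) +
     drift n kap t * (A1 t * 1 + A t * 0) = _); last by ring.
  apply: cvgD.
    exact: (cvgD (cvgD (cvgM (cst (A2 t)) c0) (cvgM (cst (2 * A1 t)) c1))
      (cvgM (cst (A t)) c2)).
  exact: (cvgM (cst _) (cvgD (cvgM (cst (A1 t)) c0) (cvgM (cst (A t)) c1))).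
have cq t (t0 : 0 < t < pi) : continuous_at t (drift n kap).
  by rewrite /drift; contf; exact: sin0.
have cA t : continuous_at t A := is_derive_continuous (dA t).
have cA1 t : continuous_at t A1 := is_derive_continuous (dA1 t).
have cf m t (t0 : 0 < t < pi) := is_derive_continuous (df m t t0).
have cf1 m t (t0 : 0 < t < pi) := is_derive_continuous (df1 m t t0).
have mg := solves_GCI_measurable gci.
have mw : measurable_fun I0pi (weight n kap).
  by apply: measurable_0pi_continuous => t _; exact: continuous_weight.
have mgw (h : R -> R) : (forall t, 0 < t < pi -> continuous_at t h) ->
    measurable_fun I0pi (fun t => g t * weight n kap t * h t).
  move=> ch; apply: measurable_funM; first exact: measurable_funM.
  exact: measurable_0pi_continuous.
have mwh (h : R -> R) : (forall t, 0 < t < pi -> continuous_at t h) ->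
    measurable_fun I0pi (fun t => weight n kap t * (sin t * h t)).
  move=> ch; apply: measurable_funM => //.
  apply: measurable_0pi_continuous => t t0; have ? := ch t t0; contf.
(* Both sides of the cutoff identity converge by domination, the left one under a multiple of |g w /
   sin|; uniqueness of limits then gives the identity for [A]. *)
have [] := @Rintegral_0pi_dominated R
  (fun m t => g t * weight n kap t * ((n%:R - 2) / sin t ^+ 2 * f m t -
      (f2 m t + drift n kap t * f1 m t)))
  (fun t => g t * weight n kap t * ((n%:R - 2) / sin t ^+ 2 * A t -
      (A2 t + drift n kap t * A1 t)))
  (fun t => 2 * K * `|g t * weight n kap t / sin t|).
- move=> m; apply: mgw => t t0.
  have ? := cf m t t0; have ? := cf1 m t t0; have ? := cf2 m t t0.
  by have ? := cq t t0; contf; rewrite expf_eq0 sin0.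
- apply: mgw => t t0.
  have ? := cA t; have ? := cA1 t; have ? := cA2 t.
  by have ? := cq t t0; contf; rewrite expf_eq0 sin0.
- exact/integrable_0piZ/integrable_norm/integrable_solves_GCI.
- move=> m t t0; have st := sin_gt0_pi t0.
  have := le_trans (ler_normB _ _) (lerD (fK m t t0) (f21K m t t0)).
  move: (_ - (f2 m t + _)) (g t * _) => y x yK.
  rewrite (normrM x y) (normrM x (sin t)^-1) mulrCA ler_wpM2l//.
  rewrite (@ger0_norm _ (sin t)^-1) ?invr_ge0 ?(ltW st)//.
  by rewrite (_ : 2 * K / sin t = K / sin t + K / sin t)//; ring.
- move=> t t0; have [c1 c2] := cvgX t t0.
  apply: cvgM; first exact: cvg_cst.
  by apply: cvgB => //; apply: cvgM => //; exact: cvg_cst.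
move=> _ cL.
have [] := @Rintegral_0pi_dominated R
  (fun m t => weight n kap t * (sin t * f m t))
  (fun t => weight n kap t * (sin t * A t))
  (fun t => C * `|weight n kap t|).
- by move=> m; apply: mwh => t t0; exact: cf.
- by apply: mwh => t t0; exact: cA.
- apply/integrable_0piZ/integrable_norm/continuous_integrable_0pi.
  exact: continuous_weight.
- move=> m t t0; rewrite normrM mulrC ler_wpM2r// normrM.
  have st := sin_gt0_pi t0; have st1 := sin_le1 t.
  rewrite (le_trans (ler_piMl _ (sin_max _)))// (le_trans (fC _ _ t0))//.
  by rewrite ler_piMr.
- move=> t t0; have [c1 c2] := cvgX t t0.
  apply: cvgM; first exact: cvg_cst.
  by apply: cvgM => //; exact: cvg_cst.
move=> _ cR; move: cL; under eq_fun do rewrite test; move=> cL.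
exact: cvg_unique cL cR.
Qed.

End MomentIdentity.

(** * The coefficients for small concentration *)

Section SmallConcentration.
Variable R : realType.
Implicit Types (f g u v phi psi : R -> R) (x t s e : R).
Notation I0pi := (`]0, (pi : R)[%classic).
Notation leb := (@lebesgue_measure R).

(** For kap > 0 this is the modified Bessel function I_{m/2}(kap) times sqrt(pi) Gamma((m+1)/2)
    (2/kap)^(m/2). *)
Definition sinmass (m : nat) (kap : R) : R :=
  \int[leb]_(t in I0pi) (expR (kap * cos t) * sin t ^+ m).

Lemma continuous_sinmass m kap :
  continuous (fun t => expR (kap * cos t) * sin t ^+ m).
Proof. by move=> t; contf. Qed.

(** Integrate the derivative of exp(kap cos) sin^(m+1) / (m+1), which vanishes at both endpoints. *)
Lemma cos_sinmass m kap :
  \int[leb]_(t in I0pi) (cos t * expR (kap * cos t) * sin t ^+ m) =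
  kap / m.+1%:R * sinmass m.+2 kap.
Proof.
pose F t := m.+1%:R^-1 * (expR (kap * cos t) * sin t ^+ m.+1).
have dF t : is_derive t 1 F (cos t * expR (kap * cos t) * sin t ^+ m -
    kap / m.+1%:R * (expR (kap * cos t) * sin t ^+ m.+2)).
  rewrite /F; derivef; rewrite /= !exprS; field.
  by rewrite addrC natr1 pnatr_eq0.
have c1 : continuous (fun t => cos t * expR (kap * cos t) * sin t ^+ m).
  by move=> t; contf.
have c2 := @continuous_sinmass m.+2 kap.
have i2 := continuous_integrable_0pi c2.
have := Rintegral_0pi_derive dF; rewrite RintegralB//; last 2 first.
- exact: continuous_integrable_0pi.
- exact: (integrable_0piZ _ i2).
rewrite RintegralZl// /F sinpi sin0 !exprS !mul0r !mulr0 subrr => H.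
apply/eqP; rewrite -subr_eq0; apply/eqP; apply: H => t.
by apply: continuous_at_subf; [exact: c1|contf].
Qed.

(** Wallis' recursion, from the derivative of cos sin^(m+1). *)
Lemma sinmass0_rec m : m.+2%:R * sinmass m.+2 0 = m.+1%:R * sinmass m 0.
Proof.
have E k : sinmass k 0 = \int[leb]_(t in I0pi) (sin t ^+ k).
  by apply: eq_Rintegral => t _; rewrite mul0r expR0 mul1r.
rewrite !E; pose F t := cos t * sin t ^+ m.+1.
have dF t : is_derive t 1 F (m.+1%:R * sin t ^+ m - m.+2%:R * sin t ^+ m.+2).
  rewrite /F; derivef; rewrite /=.
  rewrite (_ : cos t * _ = m.+1%:R * sin t ^+ m * cos t ^+ 2); last by ring.
  by rewrite cos2sin2 !exprS -[m.+2%:R]natr1; ring.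
have ic k : integrable_0pi (fun t => sin t ^+ k).
  by apply: continuous_integrable_0pi => t; contf.
have := Rintegral_0pi_derive dF; rewrite RintegralB//; last 2 first.
- exact: (integrable_0piZ _ (ic _)).
- exact: (integrable_0piZ _ (ic _)).
rewrite !RintegralZl//; try exact: ic.
rewrite /F sinpi sin0 !exprS !mul0r !mulr0 subrr => H.
apply/eqP; rewrite eq_sym -subr_eq0; apply/eqP; apply: H => t; contf.
Qed.

(** Both sides come from 1 + x <= exp x; taken at -x it gives (1 - x) exp x <= 1, and 1 / (1 - k) <=
    1 + 2 k for k <= 1 / 2. *)
Lemma expR_near0 (k x : R) : 0 <= k -> k <= 1 / 2 -> `|x| <= k ->
  1 - 2 * k <= expR x <= 1 + 2 * k.
Proof.
move=> k0 k1; rewrite ler_norml => /andP[x0 x1].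
have e1 := expR_ge1Dx x; have e2 := expR_ge1Dx (- x).
apply/andP; split; first by lra.
have ep := expR_gt0 x.
have : expR x * (1 - x) <= 1.
  by rewrite -[leRHS](expRxMexpNx_1 x) ler_pM2l.
nra.
Qed.

Lemma sinmass_near0 m (k : R) : 0 <= k -> k <= 1 / 2 ->
  (1 - 2 * k) * sinmass m 0 <= sinmass m k <= (1 + 2 * k) * sinmass m 0.
Proof.
move=> k0 k1; rewrite /sinmass -!RintegralZl//; last 2 first.
- exact/continuous_integrable_0pi/continuous_sinmass.
- exact/continuous_integrable_0pi/continuous_sinmass.
have im a := continuous_integrable_0pi (@continuous_sinmass m a).
have bd t : 1 - 2 * k <= expR (k * cos t) <= 1 + 2 * k.
  apply: expR_near0 => //.
  by rewrite normrM ger0_norm// ler_piMr// cos_max.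
apply/andP; split; (apply: le_Rintegral_0pi;
  [try exact: im; exact: (integrable_0piZ _ (im _))|
   try exact: im; exact: (integrable_0piZ _ (im _))|]);
  move=> t /sin_gt0_pi/ltW st; rewrite mul0r expR0 mul1r ler_wpM2r ?exprn_ge0//;
  by have /andP[] := bd t.
Qed.

Lemma sinmass0_gt0 m : 0 < sinmass m 0.
Proof.
elim/ltn_ind: m => -[|[|m]] IH.
- have -> : sinmass 0 0 = \int[leb]_(t in I0pi) 1.
    by apply: eq_Rintegral => t _; rewrite mul0r expR0 expr0 mulr1.
  rewrite (Rintegral_0pi_derive (fun x => is_derive_id x 1)).
    by rewrite subr0 pi_gt0.
  exact: cst_continuous.
- have -> : sinmass 1 0 = \int[leb]_(t in I0pi) sin t.
    by apply: eq_Rintegral => t _; rewrite mul0r expR0 expr1 mul1r.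
  have dc t : is_derive t 1 (fun t => - cos t) (sin t).
    by derivef; rewrite opprK.
  rewrite (Rintegral_0pi_derive dc); last exact: continuous_sin.
  by rewrite cospi cos0 opprK.
- have := sinmass0_rec m; have := IH m (leqW (leqnn _)) => m0 E.
  by rewrite -(@pmulr_rgt0 _ m.+2%:R)// E mulr_gt0.
Qed.

Lemma sinmass_gt0 m (k : R) : 0 < sinmass m k.
Proof.
apply: (@lt_le_trans _ _ (expR (- `|k|) * sinmass m 0)).
  by rewrite mulr_gt0 ?expR_gt0 ?sinmass0_gt0.
have im a := continuous_integrable_0pi (@continuous_sinmass m a).
rewrite /sinmass -RintegralZl//.
apply: le_Rintegral_0pi; [exact: (integrable_0piZ _ (im _))|exact: im|].
move=> t /sin_gt0_pi/ltW st; rewrite mul0r expR0 mul1r ler_wpM2r ?exprn_ge0//.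
rewrite ler_expR lerNl (le_trans (ler_norm _))// normrN normrM ler_piMr//.
exact: cos_max.
Qed.

Lemma sinmass_cvg m : sinmass m x @[x --> 0^'+] --> sinmass m 0.
Proof.
have id0 : (x : R) @[x --> 0^'+] --> (0 : R) by exact: cvg_at_right_filter.
have lim (a : R) : (1 + a * x) * sinmass m 0 @[x --> 0^'+] --> sinmass m 0.
  rewrite -[X in _ --> X](_ : (1 + a * 0) * sinmass m 0 = _); last by ring.
  exact: (cvgM (cvgD (cvg_cst _) (cvgM (cvg_cst a) id0)) (cvg_cst _)).
apply: (squeeze_cvgr _ (lim (-2)) (lim 2)); near=> x.
have x0 : 0 <= x by [].
have x1 : x <= 1 / 2 by near: x; apply: nbhs_right_le; lra.
by rewrite mulNr; exact: sinmass_near0.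
Unshelve. all: by end_near. Qed.

Lemma order_cE n kap : (2 <= n)%N ->
  order_c n kap = kap / (n%:R - 1) * (sinmass n kap / sinmass (n - 2) kap).
Proof.
move=> n2; rewrite /order_c !Rintegral_0pi_closed; last 2 first.
- exact: continuous_sinmass.
- by move=> t; contf.
rewrite cos_sinmass -/(sinmass _ _) -[in sinmass n](subnK n2) addn2.
by rewrite (subnSK n2) natrB ?(ltnW n2)// mulrA.
Qed.

Lemma order_c_gt0 n (kap : R) : (2 <= n)%N -> 0 < kap -> 0 < order_c n kap.
Proof.
move=> n2 k0; rewrite order_cE// mulr_gt0//.
  by rewrite divr_gt0// subr_gt0 ltr1n.
by rewrite divr_gt0// sinmass_gt0.
Qed.

(** The Wallis ratio (n - 1) / n cancels the factor 1 / (n - 1) of [order_cE]. *)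
Lemma order_c_div_cvg n : (2 <= n)%N ->
  @order_c R n x / x @[x --> 0^'+] --> (n%:R^-1 : R).
Proof.
move=> n2; have n1 : n%:R - 1 != 0 :> R.
  by rewrite gt_eqF// subr_gt0 ltr1n.
have n0 : n%:R != 0 :> R by rewrite pnatr_eq0 -lt0n ltnW.
have m0 := sinmass0_gt0 (n - 2).
rewrite -[X in _ --> X](_ :
  (n%:R - 1)^-1 * (sinmass n 0 / sinmass (n - 2) 0) = _); last first.
  have := sinmass0_rec (n - 2).
  rewrite -[in (n - 2).+2]addn2 -[in (n-2).+1]addn1 !natrD !natrB// subnK//.
  rewrite (_ : n%:R - 2%:R + 2 = n%:R)//; last by ring.
  rewrite (_ : n%:R - 2%:R + 1%:R = n%:R - 1); last by ring.
  move=> /(canRL (mulKf n0)) ->; field.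
  by rewrite n1 n0 gt_eqF.
have : (n%:R - 1)^-1 * (sinmass n x / sinmass (n - 2) x) @[x --> 0^'+] -->
    (n%:R - 1)^-1 * (sinmass n 0 / sinmass (n - 2) 0).
  apply: cvgM; first exact: cvg_cst.
  apply: cvgM; first exact: sinmass_cvg.
  by apply: cvgV; [rewrite gt_eqF|exact: sinmass_cvg].
apply: cvg_trans; apply: near_eq_cvg; near=> x.
have x0 : x != 0 by rewrite gt_eqF.
by rewrite order_cE// mulrAC (mulrAC x) divff// mul1r.
Unshelve. all: by end_near. Qed.

(** * Linear relations between the moments of g *)

Section Moments.
Variables (n : nat) (kap : R) (g : R -> R).
Hypotheses (n2 : (2 <= n)%N) (gci : solves_GCI n kap g).
Hypothesis g_ge0 : forall t, 0 < t < pi -> 0 <= g t.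

(** With g = sin h(cos), this is the integral of cos^i h(cos) exp(kappa cos) sin^n, so c~ is the
    quotient of the moments 1 and 0. *)
Definition gmoment m (k : R) (f : R -> R) (i : nat) : R :=
  \int[leb]_(t in I0pi) (f t * weight m k t * (sin t * cos t ^+ i)).
Notation M := (gmoment n kap g).

Let weight_ge0 t : 0 < t < pi -> 0 <= weight n kap t.
Proof. by move=> /sin_gt0_pi/ltW st; rewrite mulr_ge0 ?expR_ge0 ?exprn_ge0. Qed.

Lemma integrable_gmoment i :
  integrable_0pi (fun t => g t * weight n kap t * (sin t * cos t ^+ i)).
Proof.
apply: (@integrable_0pi_le _ _ (fun t => `|g t * weight n kap t / sin t|)).
- apply: measurable_funM.
    apply: measurable_funM; first exact: solves_GCI_measurable gci.
    by apply: measurable_0pi_continuous => t _; exact: continuous_weight.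
  by apply: measurable_0pi_continuous => t _; contf.
- exact/integrable_norm/integrable_solves_GCI.
move=> t t0; have st := sin_gt0_pi t0; have st1 := sin_le1 t.
move: (g t * _) => x; rewrite (normrM x (_ * _)) (normrM x _^-1) ler_wpM2l//.
apply: (@le_trans _ _ 1).
  by rewrite normrM normrX mulr_ile1 ?exprn_ge0 ?sin_max// exprn_ile1// cos_max.
by rewrite ger0_norm ?invr_ge0 ?(ltW st)// invf_ge1.
Qed.

(** This is where the sign of [g] enters: [M 0] controls all moments, which later makes every term
    with an extra factor kappa negligible. *)
Lemma gmoment_le i : `|M i| <= M 0.
Proof.
apply: (le_trans (le_normr_Rintegral _ (integrable_gmoment i))) => //.
apply: le_Rintegral_0pi.
- exact/integrable_norm/integrable_gmoment.
- exact: integrable_gmoment.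
move=> t t0; have st := sin_gt0_pi t0.
have gw : 0 <= g t * weight n kap t by rewrite mulr_ge0 ?g_ge0 ?weight_ge0.
rewrite normrM (ger0_norm gw) ler_wpM2l// expr0 mulr1 normrM gtr0_norm//.
by rewrite ler_piMr ?(ltW st)// normrX exprn_ile1// cos_max.
Qed.

Let moment (A A1 A2 : R -> R) (C : R) :=
  @solves_GCI_moment R n kap g A A1 A2 C n2 gci.

Let pi2 t : 0 < t < pi -> [/\ 0 < sin t, sin t != 0 & cos t ^+ 2 = 1 - sin t ^+ 2].
Proof.
by move=> t0; have st := sin_gt0_pi t0; rewrite gt_eqF// cos2sin2.
Qed.

Let weightE t : weight n kap t * sin t ^+ 2 = expR (kap * cos t) * sin t ^+ n.
Proof. by rewrite /weight mulrAC -exprD subnK// mulrC. Qed.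

Lemma gmoment_lin (a0 a1 a2 a3 : R) :
  \int[leb]_(t in I0pi) (g t * weight n kap t *
     (sin t * (a0 + a1 * cos t + a2 * cos t ^+ 2 + a3 * cos t ^+ 3))) =
  a0 * M 0 + a1 * M 1 + a2 * M 2 + a3 * M 3.
Proof.
have i_ k (a : R) := integrable_0piZ a (integrable_gmoment k).
rewrite /gmoment -!RintegralZl//; try exact: integrable_gmoment.
have i01 := integrable_0piD (i_ 0 a0) (i_ 1 a1).
have i02 := integrable_0piD i01 (i_ 2 a2).
rewrite -(RintegralD _ (i_ 0 a0) (i_ 1 a1))//.
rewrite -(RintegralD _ i01 (i_ 2 a2))// -(RintegralD _ i02 (i_ 3 a3))//.
by apply: eq_Rintegral_0pi => t _; rewrite expr0 expr1; ring.
Qed.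

(** For the test function sin the singular parts combine as (n - 2) (1 - cos^2) / sin = (n - 2) sin,
    and the operator returns sin (n - 1 + kappa cos). *)
Lemma gmoment_eq0 : (n%:R - 1) * M 0 + kap * M 1 = sinmass n kap.
Proof.
have dA t : is_derive t 1 sin (cos t) by exact: is_derive_sin.
have dA1 t : is_derive t 1 cos (- sin t) by exact: is_derive_cos.
have := gmoment_lin (n%:R - 1) kap 0 0; rewrite !mul0r !addr0 => <-.
transitivity (\int[leb]_(t in I0pi) (weight n kap t * (sin t * sin t))).
  rewrite -(moment dA dA1 (C := 1)).
  - apply: eq_Rintegral_0pi => t /pi2[s0 sN c2]; congr (_ * _).
    have -> : (n%:R - 2) / sin t ^+ 2 * sin t -
       (- sin t + drift n kap t * cos t) =
       ((n%:R - 2) * (1 - cos t ^+ 2) / sin t + sin t + kap * sin t * cos t).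
      by rewrite /drift; field.
    by rewrite c2; field.
  - by move=> t; contf.
  - by move=> t /pi2[s0 _ _]; rewrite mul1r gtr0_norm.
  - by move=> t _; exact: cos_max.
  - by move=> t _; rewrite normrN; exact: sin_max.
by apply: eq_Rintegral_0pi => t _; rewrite -expr2 weightE.
Qed.

(** The operator maps sin cos to sin (2 n cos + kappa (2 cos^2 - 1)). The right-hand side gains a
    factor kappa by [cos_sinmass], which makes [M 1] of order kappa. *)
Lemma gmoment_eq1 :
  2 * n%:R * M 1 + kap * (2 * M 2 - M 0) = kap / n.+1%:R * sinmass n.+2 kap.
Proof.
have dA t : is_derive t 1 (fun t => sin t * cos t) (cos t ^+ 2 - sin t ^+ 2).
  by derivef; ring.
have dA1 t : is_derive t 1 (fun t => cos t ^+ 2 - sin t ^+ 2)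
    (- (4 * sin t * cos t)).
  by derivef; rewrite /= !expr1; ring.
transitivity (- kap * M 0 + 2 * n%:R * M 1 + 2 * kap * M 2 + 0 * M 3).
  by ring.
rewrite -gmoment_lin -cos_sinmass.
transitivity (\int[leb]_(t in I0pi)
    (weight n kap t * (sin t * (sin t * cos t)))).
  rewrite -(moment dA dA1 (C := 4)).
  - apply: eq_Rintegral_0pi => t /pi2[s0 sN c2]; congr (_ * _).
    rewrite mul0r addr0 c2 /drift.
    by field.
  - by move=> t; contf.
  - move=> t /pi2[s0 _ _]; rewrite normrM gtr0_norm// mulrC ler_wpM2r ?(ltW s0)//.
    by rewrite (le_trans (cos_max _))// ler1n.
  - move=> t _; rewrite (le_trans (ler_normB _ _))//.
    rewrite (_ : 4 = 1 + 3)// lerD//.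
      by rewrite normrX exprn_ile1// cos_max.
    by rewrite normrX (@le_trans _ _ 1)// ?ler1n// exprn_ile1// sin_max.
  - move=> t _; rewrite normrN -mulrA normrM ger0_norm//.
    by rewrite ler_piMr// normrM mulr_ile1// ?sin_max ?cos_max.
apply: eq_Rintegral_0pi => t _.
by rewrite -mulrA -weightE; ring.
Qed.

(** The operator maps sin cos^2 to sin (3 (n + 1) cos^2 - 2 + kappa (3 cos^3 - 2 cos)); at leading
    order this determines [M 2] from [M 0]. *)
Lemma gmoment_eq2 :
  3 * n.+1%:R * M 2 - 2 * M 0 + kap * (3 * M 3 - 2 * M 1) =
  sinmass n kap - sinmass n.+2 kap.
Proof.
have dA t : is_derive t 1 (fun t => sin t * cos t ^+ 2)
    (cos t ^+ 3 - 2 * sin t ^+ 2 * cos t).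
  by derivef; rewrite /= !expr1; ring.
have dA1 t : is_derive t 1 (fun t => cos t ^+ 3 - 2 * sin t ^+ 2 * cos t)
    (2 * sin t ^+ 3 - 7 * sin t * cos t ^+ 2).
  by derivef; rewrite /= !expr1; ring.
transitivity (- 2 * M 0 + - 2 * kap * M 1 + 3 * n.+1%:R * M 2 + 3 * kap * M 3).
  by ring.
rewrite -gmoment_lin -RintegralB//; last 2 first.
- exact/continuous_integrable_0pi/continuous_sinmass.
- exact/continuous_integrable_0pi/continuous_sinmass.
have le3 (a b c : R) : `|a| <= 1 -> `|b| <= 1 -> `|c| <= 1 -> `|a * b * c| <= 1.
  by move=> a1 b1 c1; rewrite !normrM !mulr_ile1// mulr_ge0.
have s1 t : `|sin t| <= 1 by exact: sin_max.
have c1 t : `|cos t| <= 1 by exact: cos_max.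
transitivity (\int[leb]_(t in I0pi)
    (weight n kap t * (sin t * (sin t * cos t ^+ 2)))).
  rewrite -(moment dA dA1 (C := 9)).
  - apply: eq_Rintegral_0pi => t /pi2[s0 sN c2]; congr (_ * _).
    have -> : cos t ^+ 3 = (1 - sin t ^+ 2) * cos t by rewrite -c2; ring.
    rewrite c2 /drift -natr1.
    have -> : (n%:R - 2) / sin t ^+ 2 * (sin t * (1 - sin t ^+ 2)) -
       (2 * sin t ^+ 3 - 7 * sin t * (1 - sin t ^+ 2) +
        ((n%:R - 2) * cos t / sin t - kap * sin t) *
        ((1 - sin t ^+ 2) * cos t - 2 * sin t ^+ 2 * cos t)) =
       (n%:R - 2) / sin t * (1 - sin t ^+ 2) -
       (2 * sin t ^+ 3 - 7 * sin t * (1 - sin t ^+ 2) +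
        ((n%:R - 2) / sin t * cos t ^+ 2 - kap * sin t * cos t) *
        (1 - 3 * sin t ^+ 2)) by field.
    by rewrite c2; field.
  - by move=> t; contf.
  - move=> t /pi2[s0 _ _]; rewrite normrM gtr0_norm// mulrC ler_wpM2r ?(ltW s0)//.
    by rewrite (@le_trans _ _ 1)// ?ler1n// normrX exprn_ile1.
  - move=> t _; rewrite (le_trans (ler_normB _ _))//.
    rewrite (_ : 9 = 1 + 8)// lerD//; first by rewrite normrX exprn_ile1.
    rewrite -mulrA normrM ger0_norm// (@le_trans _ _ 2)// ?ler_nat//.
    by rewrite ler_piMr// expr2 le3.
  - move=> t _; rewrite (le_trans (ler_normB _ _))//.
    rewrite (_ : 9 = 2 + 7 :> R); last by ring.
    apply: lerD.
      by rewrite normrM ger0_norm// ler_piMr// normrX exprn_ile1.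
    by rewrite -mulrA normrM ger0_norm// ler_piMr// expr2 mulrA le3.
apply: eq_Rintegral_0pi => t _.
rewrite (_ : _ * sin t ^+ n.+2 = weight n kap t * sin t ^+ 2 * sin t ^+ 2).
  by rewrite -weightE cos2sin2; ring.
by rewrite weightE -mulrA -exprD addn2.
Qed.

End Moments.

(** * The limit of c~(kappa) / kappa *)

Lemma ctildeE n (h g : R -> R -> R) kap : (2 <= n)%N ->
  solves_GCI n kap (g kap) ->
  (forall t, 0 < t < pi -> h kap (cos t) = g kap t / sin t) ->
  ctilde n h kap = gmoment n kap (g kap) 1 / gmoment n kap (g kap) 0.
Proof.
move=> n2 gci hg.
have E i : \int[leb]_(t in `[0, pi]) (cos t ^+ i * h kap (cos t) *
    expR (kap * cos t) * sin t ^+ n) = gmoment n kap (g kap) i.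
  have eqh t : 0 < t < pi -> g kap t * weight n kap t * (sin t * cos t ^+ i) =
     cos t ^+ i * h kap (cos t) * expR (kap * cos t) * sin t ^+ n.
    move=> t0; rewrite hg// /weight -[in RHS](subnK n2) exprD.
    by field; rewrite gt_eqF// sin_gt0_pi.
  rewrite /gmoment (eq_Rintegral_0pi eqh) /Rintegral integral_itv_bndoo//.
  apply/measurable_EFinP; apply: integrable_0pi_measurable.
  exact: eq_integrable_0pi eqh (integrable_gmoment n2 gci i).
rewrite /ctilde -(E 1%N) -(E 0%N); congr (_ / _).
by apply: eq_Rintegral => t _; rewrite expr0 mul1r.
Qed.

(** The relations become triangular in the limit: the first gives [M 0], the one for sin cos^2 then
    gives [M 2], and the one for sin cos, divided by kappa, gives [M 1] / kappa. *)
Lemma ctilde_div_cvg n (h g : R -> R -> R) : (2 <= n)%N ->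
  (forall kap, 0 < kap -> solves_GCI n kap (g kap)) ->
  (forall kap t, 0 < kap -> 0 < t < pi -> h kap (cos t) = g kap t / sin t) ->
  (forall kap t, 0 < kap -> 0 < t < pi -> 0 <= g kap t) ->
  ctilde n h x / x @[x --> 0^'+] -->
    ((2 * n%:R - 1) / (2 * n%:R * (n%:R + 2)) : R).
Proof.
move=> n2 gci hg g0.
pose M i x := gmoment n x (g x) i.
have n1 : 1 <= n%:R - 1 :> R by have := n2; rewrite -(ler_nat R); lra.
pose I := sinmass n 0; have I0 : 0 < I by exact: sinmass0_gt0.
have IE : sinmass n.+2 0 = n.+1%:R / n.+2%:R * I.
  by rewrite mulrAC -sinmass0_rec mulrC mulKf// pnatr_eq0.
have cst (c : R) : c @[x --> (0 : R)^'+] --> c by exact: cvg_cst.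
have id0 : (x : R) @[x --> 0^'+] --> (0 : R) by exact: cvg_at_right_filter.
have Mle i x : 0 < x -> `|M i x| <= M 0 x.
  by move=> x0; apply: gmoment_le => //; [exact: gci|move=> t; exact: g0].
have M0 x : 0 < x -> 0 <= M 0 x.
  by move=> x0; rewrite (le_trans (normr_ge0 _) (Mle 0 x x0)).
have M0le x : 0 < x -> x <= 1 / 2 -> M 0 x <= 4 * I.
  (* For x <= 1 / 2 the first relation gives M 0 <= 2 I + x |M 1| <= 2 I + M 0 / 2: the bound closes
     on itself. *)
  move=> x0 x1; have := gmoment_eq0 n2 (gci x x0); rewrite -/(M 0 x) -/(M 1 x).
  have /andP[_] := sinmass_near0 n (ltW x0) x1; rewrite -/I.
  have := Mle 1%N x x0; rewrite ler_norml => /andP[m1 m2] s1 s2.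
  have := M0 x x0 => m0.
  have : (n%:R - 1) * M 0 x >= M 0 x by rewrite ler_peMl.
  nra.
(* [|M i x| <= 4 I], so [x M i x] is negligible. *)
have xM i : x * M i x @[x --> 0^'+] --> (0 : R).
  have lim (a : R) : a * I * x @[x --> 0^'+] --> (0 : R).
    by rewrite -[X in _ --> X](mulr0 (a * I)); exact: (cvgM (cst _) id0).
  apply: (squeeze_cvgr _ (lim (-4)) (lim 4)); near=> x.
  have x0 : 0 < x by [].
  have x1 : x <= 1 / 2 by near: x; apply: nbhs_right_le; lra.
  have := le_trans (Mle i x x0) (M0le x x0 x1).
  by rewrite ler_norml => /andP[a b]; apply/andP; split; nra.
have n1N : n%:R - 1 != 0 :> R by rewrite gt_eqF// (lt_le_trans ltr01).
have n0N : n%:R != 0 :> R by rewrite pnatr_eq0 -lt0n (ltnW n2).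
have nS : n.+1%:R = n%:R + 1 :> R by rewrite natr1.
have nSS : n.+2%:R = n%:R + 2 :> R by rewrite -addn2 natrD.
have nS0 : n%:R + 1 != 0 :> R by rewrite -nS pnatr_eq0.
have nSS0 : n%:R + 2 != 0 :> R by rewrite -nSS pnatr_eq0.
rewrite nS nSS in IE.
have near0 (f f' : R -> R) (l : R) : (forall x, 0 < x -> f x = f' x) ->
    f x @[x --> 0^'+] --> l -> f' x @[x --> 0^'+] --> l.
  move=> ff'; apply: cvg_trans; apply: near_eq_cvg; near=> x.
  by rewrite ff'.
have cM0 : M 0 x @[x --> 0^'+] --> I / (n%:R - 1).
  apply: (near0 (fun x => (sinmass n x - x * M 1 x) / (n%:R - 1))).
    move=> x x0; rewrite -(gmoment_eq0 n2 (gci x x0)) -/(M 0 x) -/(M 1 x).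
    by field.
  rewrite -[X in _ --> X](_ : (I - 0) / (n%:R - 1) = _); last by rewrite subr0.
  exact: (cvgM (cvgB (@sinmass_cvg n) (xM 1%N)) (cst _)).
have cM2 : M 2 x @[x --> 0^'+] --> I / ((n%:R - 1) * (n%:R + 2)).
  apply: (near0 (fun x => (2 * M 0 x + (sinmass n x - sinmass n.+2 x) -
      (3 * (x * M 3 x) - 2 * (x * M 1 x))) / (3 * n.+1%:R))).
    move=> x x0; have := gmoment_eq2 n2 (gci x x0).
    rewrite -/(M 0 x) -/(M 1 x) -/(M 2 x) -/(M 3 x) => <-.
    by rewrite nS; field.
  rewrite -[X in _ --> X](_ : (2 * (I / (n%:R - 1)) + (I - sinmass n.+2 0) -
      (3 * 0 - 2 * 0)) / (3 * n.+1%:R) = _); last first.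
    by rewrite IE nS; field; rewrite nS0 nSS0 n1N.
  apply: cvgM; last exact: cst.
  apply: cvgB; last exact: (cvgB (cvgM (cst 3) (xM 3)) (cvgM (cst 2) (xM 1%N))).
  by apply: cvgD; [exact: (cvgM (cst 2) cM0)|apply: cvgB; exact: sinmass_cvg].
have cM1 : M 1 x / x @[x --> 0^'+] --> (I / (n%:R + 2) -
    2 * (I / ((n%:R - 1) * (n%:R + 2))) + I / (n%:R - 1)) / (2 * n%:R).
  apply: (near0 (fun x => (sinmass n.+2 x / n.+1%:R - 2 * M 2 x + M 0 x) /
      (2 * n%:R))).
    move=> x x0; have := gmoment_eq1 n2 (gci x x0).
    rewrite -/(M 0 x) -/(M 1 x) -/(M 2 x) => E1.
    have xN : x != 0 by rewrite gt_eqF.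
    have -> : sinmass n.+2 x / n.+1%:R = (x / n.+1%:R * sinmass n.+2 x) / x.
      by rewrite mulrAC (mulrAC x) divff// mul1r mulrC.
    by rewrite -E1; field; rewrite xN.
  apply: cvgM; last exact: cst.
  apply: cvgD => //; apply: cvgB; last exact: (cvgM (cst 2) cM2).
  rewrite (_ : I / (n%:R + 2) = sinmass n.+2 0 / n.+1%:R); last first.
    by rewrite IE nS; field; rewrite nS0.
  by apply: cvgM; [exact: sinmass_cvg|exact: cst].
apply: (near0 (fun x => M 1 x / x / M 0 x)).
  move=> x x0; rewrite (ctildeE n2 (gci x x0)); last by move=> t; exact: hg.
  by rewrite mulrAC.
rewrite -[X in _ --> X](_ : (I / (n%:R + 2) - 2 * (I / ((n%:R - 1) * (n%:R + 2)))
  + I / (n%:R - 1)) / (2 * n%:R) / (I / (n%:R - 1)) = _); last first.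
  by field; rewrite (gt_eqF I0) n0N nSS0 n1N.
apply: cvgM => //; apply: cvgV => //.
by rewrite mulf_neq0 ?invr_eq0// gt_eqF.
Unshelve. all: by end_near. Qed.

End SmallConcentration.

(** * Sign of Theta near the critical density *)

Section Asymptotics.
Variable R : realType.
Implicit Types (x y r s : R).

Lemma equiv_div_cvg (f g : R -> R^o) (a : R) :
  f ~_(a^'+) g -> (\forall x \near a^'+, g x != 0) ->
  f x / g x @[x --> a^'+] --> (1 : R).
Proof.
move=> /eqaddoP fg g0; apply/cvgrPdist_le => e e0.
have := fg _ e0; apply: filterS2 g0 => x g0 /=.
rewrite -[`|f x - g x|]/(`|(f - g) x|) => h.
rewrite distrC (_ : f x / g x - 1 = (f x - g x) / g x); last by field.
by rewrite normrM normfV ler_pdivrMr ?normr_gt0.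
Qed.

Lemma cvg_at_right_gt {T : Type} {F : set_system T} {FF : Filter F}
    (f : T -> R) a :
  f x @[x --> F] --> a -> (\forall x \near F, a < f x) -> f x @[x --> F] --> a^'+.
Proof.
move=> fa af P aP; have := fa _ aP.
by apply: filterS2 af => x ax /=; exact.
Qed.

Lemma derive1_gt0_lt (f : R -> R) a b : a < b ->
  (forall x, a <= x <= b -> derivable f x 1 /\ 0 < derive1 f x) -> f a < f b.
Proof.
move=> ab df.
have [x xab| |c cab] := @MVT _ f (derive1 f) a b ab.
- have [|dx _] := df x; first by move: xab; rewrite in_itv => /andP[/ltW -> /ltW ->].
  by rewrite derive1E; exact: derivableP.
- apply: derivable_within_continuous => x xab; apply: (df x _).1.
  by move: xab; rewrite in_itv.
- move=> E; rewrite -subr_gt0 E mulr_gt0 ?subr_gt0//.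
  by apply: (df c _).2; move: cab; rewrite in_itv => /andP[/ltW -> /ltW ->].
Qed.

(** F is strictly increasing and stays above its limit rho_c, so rho < F(x0) forces kappa(rho) < x0;
    no continuity of kappa is involved. *)
Lemma branch_cvg0 (F kappa : R -> R) (kmax : \bar R) rho_c :
  F x @[x --> 0^'+] --> rho_c ->
  (forall x, 0 < x -> (x%:E < kmax)%E -> derivable F x 1 /\ 0 < derive1 F x) ->
  (forall rho, rho_c < rho ->
     [/\ 0 < kappa rho, ((kappa rho)%:E < kmax)%E & F (kappa rho) = rho]) ->
  kappa rho @[rho --> rho_c^'+] --> (0 : R).
Proof.
move=> F0 dF kap.
have mono x y : 0 < x -> x < y -> (y%:E < kmax)%E -> F x < F y.
  move=> x0 xy yk; apply: derive1_gt0_lt => // z /andP[xz zy].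
  by apply: dF; [exact: lt_le_trans xz|apply: le_lt_trans yk; rewrite lee_fin].
have rhoF x : 0 < x -> (x%:E < kmax)%E -> rho_c < F x.
  (* Passing to the limit gives only rho_c <= F(x / 2); the intermediate point x / 2 makes the
     inequality strict at x. *)
  move=> x0 xk; have x20 : 0 < x / 2 by rewrite divr_gt0.
  have x2x : x / 2 < x by rewrite ltr_pdivrMr// ltr_pMr// ltr1n.
  apply: le_lt_trans (mono _ _ x20 x2x xk).
  apply: (ler_cvg_to F0 (cvg_cst (F (x / 2)))); near=> z.
  apply/ltW/mono => //; last by rewrite (lt_trans _ xk)// lte_fin.
have [k0 kk _] : [/\ 0 < kappa (rho_c + 1), ((kappa (rho_c + 1))%:E < kmax)%E &
    F (kappa (rho_c + 1)) = rho_c + 1] by apply: kap; rewrite ltrDl.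
(* A value of the branch serves as a point below [kmax], whether [kmax] is finite or not. *)
apply/cvgrPdist_lt => e e0; pose x0 := Num.min e (kappa (rho_c + 1)).
have x00 : 0 < x0 by rewrite lt_min e0.
have x0k : (x0%:E < kmax)%E.
  by apply: le_lt_trans kk; rewrite lee_fin ge_min lexx orbT.
near=> rho.
have rr : rho_c < rho by [].
have rF : rho < F x0 by near: rho; apply: nbhs_right_lt; exact: rhoF.
have [kr0 krk Fk] := kap _ rr.
rewrite sub0r normrN gtr0_norm//; apply: (@lt_le_trans _ _ x0); last first.
  by rewrite ge_min lexx.
rewrite ltNge; apply/negP => xk; move: rF; rewrite -Fk ltNge => /negP; apply.
by move: xk; rewrite le_eqVlt => /predU1P[->//|xk]; apply/ltW/mono.
Unshelve. all: by end_near. Qed.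

(** k(0) = 0 and k has a finite slope at 0, so k(s) <= B s for small s and j(x) >= x / B. Together
    with c(x) <= 2 l x this keeps j / c above 1 / (2 l B). *)
Lemma critical_density_gt0 (k k' j c : R -> R) (kmax : \bar R) (rho_c l : R) :
  (forall r, 0 <= r -> 0 <= k r) ->
  (forall r s, 0 <= r -> r < s -> k r < k s) ->
  is_derivative_Rge0 k k' -> (0 < kmax)%E ->
  (forall x, 0 <= x -> (x%:E < kmax)%E -> 0 <= j x /\ k (j x) = x) ->
  (forall x, 0 < x -> 0 < c x) -> 0 < l ->
  c x / x @[x --> 0^'+] --> l ->
  j x / c x @[x --> 0^'+] --> rho_c -> 0 < rho_c.
Proof.
move=> k_ge0 k_inc dk kmax0 jk c0 l0 cl jc.
have [j00 kj0] := jk 0 (lexx _) kmax0.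
have j0 : j 0 = 0.
  apply/eqP; move: j00; rewrite le_eqVlt eq_sym => /predU1P[->//|j0].
  by have := k_inc _ _ (lexx 0) j0; rewrite kj0 ltNge k_ge0.
have k0 : k 0 = 0 by rewrite -{1}j0.
pose B := `|k' 0| + 1; have B0 : 0 < B by rewrite ltr_pwDr.
have [d d0 kB] : exists2 d, 0 < d & forall s, 0 < s -> s < d -> k s <= B * s.
  have /cvgrPdist_lt /(_ 1 ltr01) := dk 0 (lexx _).
  move=> /nbhs_ballP[d /= d0 db]; exists d => // s s0 sd.
  have := db s; rewrite /ball /= sub0r normrN gtr0_norm// => /(_ sd).
  rewrite k0 !subr0 in_itv /= andbT (ltW s0) gt_eqF// => /(_ isT isT) h.
  rewrite -ler_pdivrMr//; apply: (le_trans (ler_norm _)).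
  rewrite -[k s / s](subrK (k' 0)) addrC (le_trans (ler_normD _ _))// lerD2l.
  by rewrite distrC ltW.
have [e e0 ek] : exists2 e : R, 0 < e & forall x, x < e -> (x%:E < kmax)%E.
  case: kmax kmax0 {jk} => [K K0|_|//]; last by exists 1 => // x _; exact: ltry.
  by exists K; [rewrite -lte_fin|move=> x xK; rewrite lte_fin].
have lB : 0 < (2 * l * B)^-1 by rewrite invr_gt0 !mulr_gt0.
apply: (lt_le_trans lB); apply: (ler_cvg_to (cvg_cst _) jc); near=> x.
have x0 : 0 < x by [].
have xk : (x%:E < kmax)%E by apply: ek; near: x; exact: nbhs_right_lt.
have xd : x < d * B by near: x; apply: nbhs_right_lt; rewrite mulr_gt0.
have cx : c x / x < 2 * l.
  by near: x; apply: (cvgr_lt _ cl); rewrite mulr2n mulrDl mul1r ltrDl.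
have [jx kjx] := jk _ (ltW x0) xk.
have jx0 : 0 < j x.
  rewrite lt_neqAle jx andbT; apply/eqP => jx0.
  by move: x0; rewrite -kjx -jx0 k0 ltxx.
have jB : x / B <= j x.
  (* Continuity of [j] at 0 is not at hand, but if j(x) >= d the bound follows from x < d B. *)
  have [jd|jd] := ltP (j x) d; first by rewrite ler_pdivrMr// mulrC -[leLHS]kjx kB.
  by apply: le_trans jd; rewrite ler_pdivrMr// ltW.
have cx0 := c0 _ x0.
rewrite ler_pdivlMr//; apply: le_trans jB.
rewrite ltr_pdivrMr// in cx; rewrite ler_pdivlMr//.
rewrite (_ : _ * c x * B = c x / (2 * l)).
  by rewrite ler_pdivrMr ?mulr_gt0// mulrC ltW.
by field; rewrite !gt_eqF.
Unshelve. all: by end_near. Qed.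

Lemma near_sgr (f : R -> R) (a l : R) :
  f x @[x --> a^'+] --> l -> l != 0 ->
  \forall x \near a^'+, Num.sg (f x) = Num.sg l.
Proof.
move=> fl l0; have [lp|ln|l0'] := ltgtP l 0; last by rewrite l0' eqxx in l0.
- have h : \forall x \near a^'+, f x < 0 by exact: (cvgr_lt _ fl _ lp).
  by apply: filterS h => x fx; rewrite !ltr0_sg.
- have h : \forall x \near a^'+, 0 < f x by exact: (cvgr_gt _ fl _ ln).
  by apply: filterS h => x fx; rewrite !gtr0_sg.
Qed.

Lemma cvg_subr_right (a : R) : (r - a) @[r --> a^'+] --> (0 : R)^'+.
Proof.
apply: cvg_at_right_gt; last by near=> r; rewrite subr_gt0.
rewrite -[X in _ --> X](subrr a); apply: cvgB; last exact: cvg_cst.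
exact: cvg_at_right_filter.
Unshelve. all: by end_near. Qed.

(** * The sign of Theta from power laws for kappa and its derivative *)

Section ThetaSign.
Variables (kap dkap e Theta : R -> R) (r0 a b q beta : R).
Hypothesis kap_gt0 : \forall r \near r0^'+, 0 < kap r.
Hypothesis ThetaE : \forall r \near r0^'+,
  Theta r = (kap r)^-1 + e r * (r / kap r) * dkap r.
Hypothesis kap_cvg : kap r / (r - r0) `^ beta @[r --> r0^'+] --> a.
Hypothesis dkap_cvg : dkap r / (r - r0) `^ (beta - 1) @[r --> r0^'+] --> b.
Hypothesis e_cvg : e r / kap r @[r --> r0^'+] --> - q.

(** This is kappa Theta - 1 with the factor (r - r0)^(2 beta - 1) taken out. Its limit is finite for
    every beta, so the exponent alone decides which term dominates. *)
Let G r := e r / kap r * r * (kap r / (r - r0) `^ beta) *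
  (dkap r / (r - r0) `^ (beta - 1)).

Lemma gain_cvg : G r @[r --> r0^'+] --> - (q * r0 * a * b).
Proof.
rewrite -[X in _ --> X](_ : - q * r0 * a * b = _); last by ring.
apply: cvgM => //; apply: cvgM => //; apply: cvgM => //.
exact: cvg_at_right_filter.
Qed.

Lemma mul_kap_ThetaE : \forall r \near r0^'+, 0 < kap r /\
  kap r * Theta r = 1 + G r * (r - r0) `^ (2 * beta - 1).
Proof.
near=> r; have k0 : 0 < kap r by near: r.
have y0 : 0 < r - r0 by rewrite subr_gt0.
split=> //; rewrite (near ThetaE r)// /G.
have -> : (r - r0) `^ (2 * beta - 1) = (r - r0) `^ beta * (r - r0) `^ (beta - 1).
  rewrite -powRD; first by congr (_ `^ _); ring.
  by apply/implyP => _; rewrite gt_eqF.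
by field; rewrite !gt_eqF// powR_gt0.
Unshelve. all: by end_near. Qed.

Lemma sgr_mul_kap r : 0 < kap r -> Num.sg (Theta r) = Num.sg (kap r * Theta r).
Proof. by move=> k0; rewrite sgrM (gtr0_sg k0) mul1r. Qed.

Lemma powR_subr_cvg0 p : 0 < p -> (r - r0) `^ p @[r --> r0^'+] --> (0 : R).
Proof. by move=> p0; apply: cvg_comp (cvg_subr_right r0) (powR_cvg0 p0). Qed.

Lemma Theta_gt0 : 1 / 2 < beta -> \forall r \near r0^'+, 0 < Theta r.
Proof.
move=> b2; have p0 : 0 < 2 * beta - 1 by lra.
have lim : 1 + G r * (r - r0) `^ (2 * beta - 1) @[r --> r0^'+] --> (1 : R).
  rewrite -[X in _ --> X](_ : 1 + - (q * r0 * a * b) * 0 = _); last by ring.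
  apply: cvgD; first exact: cvg_cst.
  by apply: cvgM; [exact: gain_cvg|exact: powR_subr_cvg0].
have := near_sgr lim (oner_neq0 _).
apply: filterS2 mul_kap_ThetaE => r [k0 E].
by rewrite -E -sgr_mul_kap// sgr1 => /eqP; rewrite sgr_cp0.
Qed.

(** The power now blows up; factoring it out leaves (r - r0)^(1 - 2 beta) + G, which has a finite
    negative limit. *)
Lemma Theta_lt0 : beta < 1 / 2 -> 0 < q * r0 * a * b ->
  \forall r \near r0^'+, Theta r < 0.
Proof.
move=> b2 q0; have p0 : 0 < 1 - 2 * beta by lra.
have lim : (r - r0) `^ (1 - 2 * beta) + G r @[r --> r0^'+] -->
    - (q * r0 * a * b).
  rewrite -[X in _ --> X]add0r.
  by apply: cvgD; [exact: powR_subr_cvg0|exact: gain_cvg].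
near=> r.
have [k0 E] : 0 < kap r /\
  kap r * Theta r = 1 + G r * (r - r0) `^ (2 * beta - 1).
  by near: r; exact: mul_kap_ThetaE.
have y0 : 0 < r - r0 by rewrite subr_gt0.
have yp : 0 < (r - r0) `^ (2 * beta - 1) by rewrite powR_gt0.
rewrite -(pmulr_rlt0 _ k0) E.
have -> : 1 + G r * (r - r0) `^ (2 * beta - 1) =
    (r - r0) `^ (2 * beta - 1) * ((r - r0) `^ (1 - 2 * beta) + G r).
  rewrite mulrDr -powRD; last by apply/implyP => _; rewrite gt_eqF.
  by rewrite (_ : 2 * beta - 1 + _ = 0); [rewrite powRr0 (mulrC (G r))|ring].
rewrite pmulr_rlt0//; near: r; apply: (cvgr_lt _ lim).
by rewrite oppr_lt0.
Unshelve. all: by end_near. Qed.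

Lemma Theta_sg : beta = 1 / 2 -> 1 - q * r0 * a * b != 0 ->
  \forall r \near r0^'+, Num.sg (Theta r) = Num.sg (1 - q * r0 * a * b).
Proof.
move=> b2 q0; have p0 : 2 * beta - 1 = 0 by lra.
have lim : 1 + G r @[r --> r0^'+] --> 1 - q * r0 * a * b.
  by apply: cvgD; [exact: cvg_cst|exact: gain_cvg].
have := near_sgr lim q0.
apply: filterS2 mul_kap_ThetaE => r [k0 E].
by rewrite sgr_mul_kap// E p0 powRr0 mulr1.
Qed.

End ThetaSign.

(** If beta <= 0, the power is at least 1 near r0, so the quotient would be less than 1 / 2 there
    together with f / a, instead of tending to 1. *)
Lemma exponent_gt0 (f : R -> R) (r0 a beta : R) : 0 < a ->
  f r @[r --> r0^'+] --> (0 : R) ->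
  f r / (a * (r - r0) `^ beta) @[r --> r0^'+] --> (1 : R) -> 0 < beta.
Proof.
move=> a0 f0 f1; rewrite ltNge; apply/negP => b0.
have : f r / a @[r --> r0^'+] --> (0 : R).
  by rewrite -[X in _ --> X](mul0r a^-1); apply: cvgM => //; exact: cvg_cst.
move=> fa.
have h : \forall r \near r0^'+, f r / a < 1 / 2.
  by apply: (cvgr_lt _ fa); lra.
have l1 : \forall r \near r0^'+, 1 / 2 < f r / (a * (r - r0) `^ beta).
  by apply: (cvgr_gt _ f1); lra.
suff : \forall r \near r0^'+, False by move=> /filter_ex[].
near=> r.
have y0 : 0 < r - r0 by rewrite subr_gt0.
have y1 : r - r0 <= 1.
  by rewrite lerBlDl; near: r; apply: nbhs_right_le; rewrite ltrDl.
have p1 : 1 <= (r - r0) `^ beta.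
  rewrite -(powRr0 (r - r0)); apply: ger_powR => //; by rewrite y0.
have h1 : f r / a < 1 / 2 by near: r.
have h2 : 1 / 2 < f r / (a * (r - r0) `^ beta) by near: r.
move: h2; rewrite invfM mulrA => h2.
have : f r / a / (r - r0) `^ beta < 1 / 2; last by rewrite ltNge (ltW h2).
have p0 : 0 < (r - r0) `^ beta by rewrite powR_gt0.
rewrite ltr_pdivrMr//; apply: (lt_le_trans h1); lra.
Unshelve. all: by end_near. Qed.

End Asymptotics.

(** * Application to the branch near the critical density *)

Theorem proposition5p4 (R : realType) (n : nat) (nu tau j : R -> R)
    (kmax : \bar R) (g h : R -> R -> R) (rho_c : R) (kappa : R -> R)
    (alpha0 beta : R) :
  let k := fun r : R => nu r / tau r in
  let c := @order_c R n in
  let c1 := soh_c1 n kappa in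
  let c2 := soh_c2 n h kappa in
  let Theta := soh_Theta n h kappa in
  let alpha_c := Num.sqrt (4 * (n%:R + 2) / (5 * n%:R * rho_c)) in
  (2 <= n)%N ->
  (* nu, tau and k *)
  (forall r, 0 <= r -> 0 <= nu r /\ 0 < tau r) ->
  [lipschitz (nu r / r : R^o) | r in (`]0, +oo[%classic : set R)] ->
  [bounded (nu r / r : R^o) | r in (`]0, +oo[%classic : set R)] ->
  [lipschitz (tau r : R^o) | r in (`[0, +oo[%classic : set R)] ->
  [bounded (tau r : R^o) | r in (`[0, +oo[%classic : set R)] ->
  (forall r s, 0 <= r -> r < s -> k r < k s) ->
  (exists2 k' : R -> R, is_derivative_Rge0 k k' &
     [lipschitz (k' r : R^o) | r in (`[0, +oo[%classic : set R)]) ->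
  (* kmax and the inverse j of k *)
  (k r)%:E @[r --> +oo] --> kmax ->
  (forall x, 0 <= x -> (x%:E < kmax)%E -> 0 <= j x /\ k (j x) = x) ->
  (forall r, 0 <= r -> j (k r) = r) ->
  (* g_kappa and h_kappa *)
  (forall kap, 0 < kap -> solves_GCI n kap (g kap)) ->
  (forall kap t, 0 < kap -> 0 < t -> t < pi -> h kap (cos t) = g kap t / sin t) ->
  (forall kap mu, 0 < kap -> -1 <= mu -> mu <= 1 -> 0 < h kap mu) ->
  (* second order phase transition, with finite critical density rho_c *)
  (j x / c x @[x --> 0^'+] --> rho_c) ->
  (forall x, 0 < x -> (x%:E < kmax)%E ->
     derivable (fun y => j y / c y) x 1 /\ 0 < derive1 (fun y => j y / c y) x) ->
  (* the branch kappa(rho), rho > rho_c *)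
  (forall rho, rho_c < rho ->
     [/\ 0 < kappa rho, ((kappa rho)%:E < kmax)%E &
         j (kappa rho) = rho * c (kappa rho)]) ->
  (* critical exponent *)
  0 < alpha0 ->
  (fun rho => c (kappa rho) : R^o) ~_(rho_c^'+)
    (fun rho => alpha0 * (rho - rho_c) `^ beta : R^o) ->
  (fun rho => derive1 kappa rho : R^o) ~_(rho_c^'+)
    (fun rho => n%:R * alpha0 * beta * (rho - rho_c) `^ (beta - 1) : R^o) ->
  [/\ beta < 1 / 2 ->
        \forall rho \near rho_c^'+, Theta rho < 0 /\
          (forall Om, unit_sphere Om -> ~ @soh_hyperbolic_at R n c1 c2 Theta rho Om),
      1 / 2 < beta ->
        \forall rho \near rho_c^'+, 0 < Theta rho /\
          (forall Om, unit_sphere Om -> @soh_hyperbolic_at R n c1 c2 Theta rho Om) &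
      beta = 1 / 2 -> alpha0 <> alpha_c ->
        \forall rho \near rho_c^'+, Num.sg (Theta rho) = Num.sg (alpha_c - alpha0)].
Proof.
move=> k c c1 c2 Theta alpha_c n2 nutau _ _ _ _ kinc [k' dk _] _ jk _ gci hg hpos
  jc djc branch a0 ceq dkeq.
have n0 : 0 < n%:R :> R by rewrite ltr0n ltnW.
have c_gt0 x : 0 < x -> 0 < c x by exact: order_c_gt0.
have branch' rho : rho_c < rho -> [/\ 0 < kappa rho, ((kappa rho)%:E < kmax)%E &
    j (kappa rho) / c (kappa rho) = rho].
  move=> rr; have [kr0 krk ->] := branch _ rr; split=> //.
  by rewrite mulfK// gt_eqF// c_gt0.
have kap0 := branch_cvg0 jc djc branch'.
have kap_gt0 : \forall rho \near rho_c^'+, 0 < kappa rho.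
  by near=> rho; have [] := branch rho _.
have kap0p : kappa r @[r --> rho_c^'+] --> 0^'+.
  exact: cvg_at_right_gt kap0 kap_gt0.
have kmax0 : (0 < kmax)%E.
  have [|k1 kk _] := branch (rho_c + 1); first by rewrite ltrDl.
  by apply: lt_trans kk; rewrite lte_fin.
have rc0 : 0 < rho_c.
  apply: (critical_density_gt0 _ kinc dk kmax0 jk c_gt0 _
    (@order_c_div_cvg R n n2) jc); last by rewrite invr_gt0.
  by move=> r /nutau[nu0 tau0]; rewrite divr_ge0// ltW.
have ckap : c (kappa r) / kappa r @[r --> rho_c^'+] --> (n%:R^-1 : R).
  exact: cvg_comp kap0p (@order_c_div_cvg R n n2).
have ctkap : ctilde n h (kappa r) / kappa r @[r --> rho_c^'+] -->
    ((2 * n%:R - 1) / (2 * n%:R * (n%:R + 2)) : R).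
  suff ct : ctilde n h x / x @[x --> 0^'+] -->
      ((2 * n%:R - 1) / (2 * n%:R * (n%:R + 2)) : R) by exact: cvg_comp kap0p ct.
  apply: (@ctilde_div_cvg R n h g n2 gci).
    by move=> kap t kp /andP[]; exact: hg.
  move=> kap t kp t0; have st := sin_gt0_pi t0.
  have := hpos kap (cos t) kp (cos_geN1 t) (cos_le1 t).
  case/andP: t0 => t0 tpi.
  by rewrite hg// => /ltW; rewrite pmulr_lge0// invr_gt0.
have cst (x : R) : x @[_ --> rho_c^'+] --> x by exact: cvg_cst.
have ypow (p : R) : \forall rho \near rho_c^'+, 0 < (rho - rho_c) `^ p.
  by near=> rho; rewrite powR_gt0// subr_gt0.
have ceq1 : c (kappa r) / (alpha0 * (r - rho_c) `^ beta) @[r --> rho_c^'+] --> (1 : R).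
  apply: (equiv_div_cvg ceq); apply: filterS (ypow beta) => rho p0.
  by rewrite gt_eqF// mulr_gt0.
(* c(kappa) = (c(kappa) / kappa) kappa tends to 0 along the branch. Positivity of beta makes the
   equivalent of the derivative nonzero and fixes the sign of the gain. *)
have b0 : 0 < beta.
  apply: (exponent_gt0 a0 _ ceq1).
  rewrite -[X in _ --> X](mulr0 n%:R^-1).
  apply: cvg_trans (cvgM ckap kap0); apply: near_eq_cvg; near=> rho.
  have kr0 : 0 < kappa rho by near: rho.
  by rewrite /= divfK// gt_eqF.
(* The law given for c(kappa) is transferred to kappa by multiplying with kappa / c(kappa), which
   tends to n. *)
have kapcvg : kappa r / (r - rho_c) `^ beta @[r --> rho_c^'+] --> (n%:R * alpha0 : R).
  rewrite -[X in _ --> X](_ : 1 / n%:R^-1 * alpha0 = _); last first.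
    by field; rewrite gt_eqF.
  apply: cvg_trans
    (cvgM (cvgM ceq1 (cvgV (invr_neq0 (lt0r_neq0 n0)) ckap)) (cst alpha0)).
  apply: near_eq_cvg; near=> rho.
  have kr0 : 0 < kappa rho by near: rho.
  have p0 : 0 < (rho - rho_c) `^ beta by near: rho.
  have ck := c_gt0 _ kr0.
  by rewrite /=; field; rewrite !gt_eqF.
have dkcvg : derive1 kappa r / (r - rho_c) `^ (beta - 1) @[r --> rho_c^'+] -->
    (n%:R * alpha0 * beta : R).
  have nab : 0 < n%:R * alpha0 * beta by rewrite !mulr_gt0.
  have d1 : derive1 kappa r / (n%:R * alpha0 * beta * (r - rho_c) `^ (beta - 1))
      @[r --> rho_c^'+] --> (1 : R).
    apply: (equiv_div_cvg dkeq); apply: filterS (ypow (beta - 1)) => rho p0.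
    by rewrite gt_eqF// mulr_gt0.
  rewrite -[X in _ --> X]mul1r.
  apply: cvg_trans (cvgM d1 (cst (n%:R * alpha0 * beta))).
  apply: near_eq_cvg; near=> rho.
  have p0 : 0 < (rho - rho_c) `^ (beta - 1) by near: rho; exact: ypow.
  by rewrite /=; field; rewrite !gt_eqF.
have n20 : 0 < n%:R + 2 :> R by rewrite addr_gt0.
(* q = 1 / n - (2 n - 1) / (2 n (n + 2)), the difference of the slopes of c and c~ at kappa = 0. *)
have [q qE q0] : exists2 q : R, q = 5 / (2 * n%:R * (n%:R + 2)) & 0 < q.
  by eexists; rewrite // divr_gt0// !mulr_gt0.
have ecvg : (ctilde n h (kappa r) - c (kappa r)) / kappa r @[r --> rho_c^'+] --> - q.
  rewrite -[X in _ --> X](_ : (2 * n%:R - 1) / (2 * n%:R * (n%:R + 2)) - n%:R^-1 = _).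
    by under eq_fun do rewrite mulrBl; exact: cvgB.
  by rewrite qE; field; rewrite !gt_eqF.
have ThetaE : \forall r \near rho_c^'+, Theta r = (kappa r)^-1 +
    (ctilde n h (kappa r) - c (kappa r)) * (r / kappa r) * derive1 kappa r.
  by apply: nearW => r.
have c1_gt0 : \forall rho \near rho_c^'+, 0 < c1 rho.
  by apply: filterS kap_gt0 => rho; exact: c_gt0.
have rho_gt0 : \forall rho \near rho_c^'+, 0 < rho.
  by near=> rho; apply: (lt_trans rc0).
split=> [b2|b2|b2 aac].
- have q1 : 0 < q * rho_c * (n%:R * alpha0) * (n%:R * alpha0 * beta).
    by rewrite !mulr_gt0.
  have Th := Theta_lt0 kap_gt0 ThetaE kapcvg dkcvg ecvg b2 q1.
  near=> rho; have Thr : Theta rho < 0 by near: rho.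
  have rho0 : 0 < rho by near: rho.
  have c10 : 0 < c1 rho by near: rho.
  by split=> // Om Om1; exact: soh_hyperbolic_lt0.
- have Th := Theta_gt0 kap_gt0 ThetaE kapcvg dkcvg ecvg b2.
  near=> rho; have Thr : 0 < Theta rho by near: rho.
  have rho0 : 0 < rho by near: rho.
  have c10 : 0 < c1 rho by near: rho.
  by split=> // Om Om1; exact: soh_hyperbolic_gt0.
- have Th := Theta_sg kap_gt0 ThetaE kapcvg dkcvg ecvg b2.
  have ac2 : alpha_c ^+ 2 = 4 * (n%:R + 2) / (5 * n%:R * rho_c).
    by rewrite sqr_sqrtr// ltW// divr_gt0// ?mulr_gt0.
  have ac0 : 0 < alpha_c by rewrite sqrtr_gt0 divr_gt0// ?mulr_gt0.
  (* At beta = 1 / 2 the limit is 1 - alpha0^2 / alpha_c^2, since q rho_c n^2 / 2 = 1 / alpha_c^2;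
     factoring the difference of squares isolates the sign. *)
  have E : 1 - q * rho_c * (n%:R * alpha0) * (n%:R * alpha0 * beta) =
      (alpha_c - alpha0) * ((alpha_c + alpha0) / alpha_c ^+ 2).
    rewrite [RHS]mulrA -subr_sqr mulrBl divff ?expf_neq0 ?gt_eqF//.
    by rewrite ac2 qE b2; field; rewrite !gt_eqF.
  have p0 : 0 < (alpha_c + alpha0) / alpha_c ^+ 2.
    by rewrite divr_gt0 ?addr_gt0 ?exprn_gt0.
  rewrite E in Th.
  have Thn : (alpha_c - alpha0) * ((alpha_c + alpha0) / alpha_c ^+ 2) != 0.
    rewrite mulf_neq0 ?(gt_eqF p0)// subr_eq0; apply/eqP => e; exact: aac.
  apply: filterS (Th Thn) => rho ->.
  by rewrite sgrM (gtr0_sg p0) mulr1.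
Unshelve. all: by end_near. Qed.
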